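(* Let $R$ be a commutative noetherian local ring which is either complete or has uncountable residue field. Let $\mathcal{X}$ be a resolving subcategory of $\mathrm{mod}\,R$ in which there are only countably many nonisomorphic indecomposable $R$-modules. Then $\dim\mathrm{NF}(\mathcal{X})\le 1$.
   Context: All $R$-modules are assumed finitely generated; $\mathrm{mod}\,R$ is the category of finitely generated $R$-modules. A subcategory of $\mathrm{mod}\,R$ means a full subcategory closed under isomorphisms. A subcategory $\mathcal{X}$ of $\mathrm{mod}\,R$ is resolving if it contains all projective $R$-modules, is closed under direct summands, is closed under extensions (if $0\to L\to M\to N\to 0$ is exact and $L,N\in\mathcal{X}$, then $M\in\mathcal{X}$), and is closed under kernels of epimorphisms (if $0\to L\to M\to N\to 0$ is exact and $M,N\in\mathcal{X}$, then $L\in\mathcal{X}$). The nonfree locus $\mathrm{NF}(X)$ of an $R$-module $X$ is the set of prime ideals $\mathfrak{p}$ of $R$ such that the $R_{\mathfrak{p}}$-module $X_{\mathfrak{p}}$ is not free; for a subcategory $\mathcal{X}$, $\mathrm{NF}(\mathcal{X})=\bigcup_{X\in\mathcal{X}}\mathrm{NF}(X)$. The dimension $\dim Z$ of a subset $Z\subseteq\mathrm{Spec}\,R$ is the supremum of $\dim R/\mathfrak{p}$ over $\mathfrak{p}\in Z$. *)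

(* Defs.v *)
From HB Require Import structures.
From mathcomp Require Import all_boot all_order all_algebra.
From mathcomp Require Import generic_quotient ring_quotient ring zify.
From mathcomp Require Import boolp classical_sets cardinality constructive_ereal.

Set Implicit Arguments.
Unset Strict Implicit.
Unset Printing Implicit Defensive.

Import Order.TTheory GRing.Theory Num.Theory.

Local Open Scope ring_scope.
Local Open Scope quotient_scope.
Local Open Scope classical_set_scope.

(* Ideals in the sense of [idealr] and [prime_idealr] are proper. They are     *)
(* boolean predicates, which is classically no restriction.                    *)

Section Localization.
Variables (R : comNzRingType) (p : prime_idealr R).

Record denom := Denom { dval : R; dvalP : dval \notin p }.
HB.instance Definition _ := [isSub for dval].
HB.instance Definition _ := [Choice of denom by <:].

Lemma denom1_subproof : 1 \notin p.
Proof. by rewrite idealr1. Qed.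

Lemma denomM_subproof (s t : denom) : dval s * dval t \notin p.
Proof. by rewrite prime_idealrM negb_or (dvalP s) (dvalP t). Qed.

Definition denom1 : denom := Denom denom1_subproof.
Definition denomM (s t : denom) : denom := Denom (denomM_subproof s t).

Section Module.
Variable M : lmodType R.

Definition loc_rel (x y : M * denom) : bool :=
  `[< exists u : denom, (dval u * dval y.2) *: x.1 = (dval u * dval x.2) *: y.1 >].

Lemma loc_rel_refl : reflexive loc_rel.
Proof. by move=> x; apply/asboolP; exists denom1. Qed.

Lemma loc_rel_sym : symmetric loc_rel.
Proof. by move=> x y; apply/asboolP/asboolP => -[u e]; exists u. Qed.

Lemma loc_rel_trans : transitive loc_rel.
Proof.
move=> y x z /asboolP[u /= e1] /asboolP[v /= e2]; apply/asboolP.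
exists (denomM (denomM u v) y.2) => /=.
have -> : dval u * dval v * dval y.2 * dval z.2
          = (dval v * dval z.2) * (dval u * dval y.2) by ring.
rewrite -scalerA e1 scalerA.
have -> : dval v * dval z.2 * (dval u * dval x.2)
          = (dval u * dval x.2) * (dval v * dval z.2) by ring.
by rewrite -scalerA e2 scalerA; congr (_ *: _); ring.
Qed.

Canonical loc_equiv := EquivRel loc_rel loc_rel_refl loc_rel_sym loc_rel_trans.

Definition localize := {eq_quot loc_rel}.
HB.instance Definition _ : EqQuotient _ loc_rel localize :=
  EqQuotient.on localize.
HB.instance Definition _ := Choice.on localize.

Definition lfrac (x : M) (s : denom) : localize := \pi_localize (x, s).

Lemma lfracP x s y t :
  lfrac x s = lfrac y t <->
  exists u : denom, (dval u * dval t) *: x = (dval u * dval s) *: y.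
Proof.
split=> [/eqP|h]; first by rewrite /lfrac eqmodE => /asboolP.
by apply/eqP; rewrite /lfrac eqmodE; apply/asboolP.
Qed.

Lemma lfracK (a : localize) : lfrac (repr a).1 (repr a).2 = a.
Proof. by rewrite /lfrac -surjective_pairing reprK. Qed.

Lemma lfrac_ind (P : localize -> Prop) :
  (forall x s, P (lfrac x s)) -> forall a, P a.
Proof. by move=> h a; rewrite -(lfracK a). Qed.

Lemma lfrac_repr x s : exists u : denom,
  (dval u * dval s) *: (repr (lfrac x s)).1
  = (dval u * dval (repr (lfrac x s)).2) *: x.
Proof. by apply/lfracP; rewrite lfracK. Qed.

Definition ladd (a b : localize) : localize :=
  lfrac (dval (repr b).2 *: (repr a).1 + dval (repr a).2 *: (repr b).1)
        (denomM (repr a).2 (repr b).2).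
Definition lopp (a : localize) : localize := lfrac (- (repr a).1) (repr a).2.
Definition lzero : localize := lfrac 0 denom1.

Lemma laddE x s y t :
  ladd (lfrac x s) (lfrac y t) = lfrac (dval t *: x + dval s *: y) (denomM s t).
Proof.
have [u hu] := lfrac_repr x s; have [v hv] := lfrac_repr y t.
rewrite /ladd; move: (repr (lfrac x s)) (repr (lfrac y t)) hu hv.
move=> [x' s'] [y' t'] /= hu hv; apply/lfracP; exists (denomM u v) => /=.
rewrite !scalerDr !scalerA; congr (_ + _).
- have -> : dval u * dval v * (dval s * dval t) * dval t'
            = (dval v * dval t * dval t') * (dval u * dval s) by ring.
  by rewrite -scalerA hu scalerA; congr (_ *: _); ring.
- have -> : dval u * dval v * (dval s * dval t) * dval s'
            = (dval u * dval s * dval s') * (dval v * dval t) by ring.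
  by rewrite -scalerA hv scalerA; congr (_ *: _); ring.
Qed.

Lemma loppE x s : lopp (lfrac x s) = lfrac (- x) s.
Proof.
have [u hu] := lfrac_repr x s.
by rewrite /lopp; apply/lfracP; exists u; rewrite !scalerN hu.
Qed.

Lemma laddA : associative ladd.
Proof.
elim/lfrac_ind=> x s; elim/lfrac_ind=> y t; elim/lfrac_ind=> z w.
rewrite !laddE; apply/lfracP; exists denom1 => /=.
rewrite !scalerDr !scalerA -!addrA.
by congr (_ *: _ + (_ *: _ + _ *: _)); ring.
Qed.

Lemma laddC : commutative ladd.
Proof.
elim/lfrac_ind=> x s; elim/lfrac_ind=> y t.
rewrite !laddE addrC; apply/lfracP; exists denom1 => /=.
by congr (_ *: _); ring.
Qed.

Lemma ladd0 : left_id lzero ladd.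
Proof.
elim/lfrac_ind=> x s; rewrite laddE scaler0 add0r scale1r.
by apply/lfracP; exists denom1 => /=; congr (_ *: _); ring.
Qed.

Lemma laddN : left_inverse lzero lopp ladd.
Proof.
elim/lfrac_ind=> x s; rewrite loppE laddE scalerN addNr.
by apply/lfracP; exists denom1; rewrite !scaler0.
Qed.

HB.instance Definition _ := GRing.isZmodule.Build localize laddA laddC ladd0 laddN.

Lemma lfracD x s y t :
  lfrac x s + lfrac y t = lfrac (dval t *: x + dval s *: y) (denomM s t).
Proof. exact: laddE. Qed.

End Module.

Definition lscale (M : lmodType R) (a : localize R^o) (x : localize M) :
  localize M := lfrac ((repr a).1 *: (repr x).1) (denomM (repr a).2 (repr x).2).

Lemma lscaleE (M : lmodType R) (a : R) s (x : M) t :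
  lscale (lfrac (a : R^o) s) (lfrac x t) = lfrac (a *: x) (denomM s t).
Proof.
have [u hu] := lfrac_repr (a : R^o) s; have [v hv] := lfrac_repr x t.
rewrite /lscale.
move: (repr (lfrac (a : R^o) s)) (repr (lfrac x t)) hu hv.
move=> [a' s'] [x' t'] /= hu hv; apply/lfracP; exists (denomM u v) => /=.
rewrite !scalerA.
have -> : dval u * dval v * (dval s * dval t) * a'
          = (dval u * dval s * a') * (dval v * dval t) by ring.
rewrite -scalerA hv scalerA.
have {}hu : dval u * dval s * a' = dval u * dval s' * a := hu.
by rewrite hu; congr (_ *: _); ring.
Qed.

(* The ring R_p has the localized module (R^o)_p as its underlying group, and *)
(* lscale, which is the action of R_p on M_p, as its multiplication.          *)
Definition locring : Type := localize R^o.
HB.instance Definition _ := GRing.Zmodule.on locring.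

Definition lone : locring := lfrac (1 : R^o) denom1.
Definition lmul (a b : locring) : locring := lscale a b.

Lemma lmulE (a : R) s (b : R) t :
  lmul (lfrac (a : R^o) s) (lfrac (b : R^o) t)
  = lfrac (a * b : R^o) (denomM s t).
Proof. exact: lscaleE. Qed.

Lemma lringP (a b : R) s t :
  lfrac (a : R^o) s = lfrac (b : R^o) t <->
  exists u : denom, dval u * dval t * a = dval u * dval s * b.
Proof. exact: lfracP. Qed.

Lemma lring_ind (P : locring -> Prop) :
  (forall (a : R) s, P (lfrac (a : R^o) s)) -> forall a, P a.
Proof. by move=> h a; rewrite -(lfracK a); apply: h. Qed.

Lemma lringD (a b : R) s t :
  (lfrac (a : R^o) s : locring) + lfrac (b : R^o) t
  = lfrac (dval t * a + dval s * b : R^o) (denomM s t).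
Proof. exact: lfracD. Qed.

Lemma lmulA : associative lmul.
Proof.
elim/lring_ind=> a s; elim/lring_ind=> b t; elim/lring_ind=> c w.
by rewrite !lmulE; apply/lringP; exists denom1 => /=; ring.
Qed.

Lemma lmulC : commutative lmul.
Proof.
elim/lring_ind=> a s; elim/lring_ind=> b t.
by rewrite !lmulE; apply/lringP; exists denom1 => /=; ring.
Qed.

Lemma lmul1 : left_id lone lmul.
Proof.
elim/lring_ind=> a s.
by rewrite lmulE; apply/lringP; exists denom1 => /=; ring.
Qed.

Lemma lmulDl : left_distributive lmul +%R.
Proof.
elim/lring_ind=> a s; elim/lring_ind=> b t; elim/lring_ind=> c w.
by rewrite lringD !lmulE lringD; apply/lringP; exists denom1 => /=; ring.
Qed.

Lemma lone_neq0 : lone != 0.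
Proof.
apply/eqP => /lringP[u]; rewrite /= mulr0 !mulr1 => u0.
by have := dvalP u; rewrite u0 idealr0.
Qed.

HB.instance Definition _ := GRing.Zmodule_isComNzRing.Build locring
  lmulA lmulC lmul1 lmulDl lone_neq0.

Lemma lringM (a b : R) s t :
  (lfrac (a : R^o) s : locring) * lfrac (b : R^o) t
  = lfrac (a * b : R^o) (denomM s t).
Proof. exact: lmulE. Qed.

Section LModule.
Variable M : lmodType R.

Lemma lscaleA (a b : locring) (x : localize M) :
  lscale a (lscale b x) = lscale (a * b) x.
Proof.
elim/lring_ind: a => a s; elim/lring_ind: b => b t.
elim/lfrac_ind: x => x w; rewrite lringM !lscaleE.
apply/lfracP; exists denom1 => /=.
by rewrite !scalerA; congr (_ *: _); ring.
Qed.

Lemma lscale1 : left_id (1 : locring) (@lscale M).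
Proof.
elim/lfrac_ind=> x s; rewrite lscaleE scale1r; apply/lfracP; exists denom1 => /=.
by congr (_ *: _); ring.
Qed.

Lemma lscaleDr : right_distributive (@lscale M) +%R.
Proof.
elim/lring_ind=> a s; elim/lfrac_ind=> x t; elim/lfrac_ind=> y w.
rewrite lfracD !lscaleE lfracD; apply/lfracP; exists denom1 => /=.
rewrite !scalerDr !scalerA.
by congr (_ *: _ + _ *: _); ring.
Qed.

Lemma lscaleDl (x : localize M) :
  {morph (@lscale M)^~ x : a b / (a : locring) + b >-> a + b}.
Proof.
elim/lfrac_ind: x => x w; elim/lring_ind=> a s; elim/lring_ind=> b t.
rewrite lringD !lscaleE lfracD; apply/lfracP; exists denom1 => /=.
rewrite scalerDl !scalerDr !scalerA.
by congr (_ *: _ + _ *: _); ring.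
Qed.

HB.instance Definition _ := GRing.Zmodule_isLmodule.Build locring (localize M)
  lscaleA lscale1 lscaleDr lscaleDl.

End LModule.
End Localization.

Section Modules.
Variable R : comNzRingType.
Implicit Types L M N P : lmodType R.

Definition finitely_generated M : Prop :=
  exists n (v : 'I_n -> M), forall x, exists c : 'I_n -> R,
    x = \sum_i c i *: v i.

Definition free_module M : Prop :=
  exists B : set M,
    (forall x, exists (s : seq M) (c : M -> R),
        (forall b, b \in s -> B b) /\ x = \sum_(b <- s) c b *: b) /\
    (forall (s : seq M) (c : M -> R),
        uniq s -> (forall b, b \in s -> B b) ->
        \sum_(b <- s) c b *: b = 0 -> forall b, b \in s -> c b = 0).

Definition projective_module P : Prop :=
  forall M N (g : {linear M -> N}) (f : {linear P -> N}),
    (forall y, exists x, g x = y) ->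
    exists h : {linear P -> M}, forall x, g (h x) = f x.

Definition iso_module M N : Prop := exists f : {linear M -> N}, bijective f.

Definition short_exact L M N (f : {linear L -> M}) (g : {linear M -> N}) : Prop :=
  [/\ injective f, forall z, exists y, g y = z &
      forall y, g y = 0 <-> exists x, f x = y].

Definition zero_module M : Prop := forall x : M, x = 0.

Definition indecomposable M : Prop :=
  ~ zero_module M /\
  forall L N, iso_module M (L * N)%type -> zero_module L \/ zero_module N.

Record subcategory (X : lmodType R -> Prop) : Prop := {
  subcategory_fg : forall M, X M -> finitely_generated M;
  subcategory_iso : forall M N, iso_module M N -> X M -> X N }.

Record resolving (X : lmodType R -> Prop) : Prop := {
  resolving_subcategory : subcategory X;
  resolving_projective : forall P,
    finitely_generated P -> projective_module P -> X P;
  resolving_summand : forall M N, X (M * N)%type -> X M;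
  resolving_extension : forall L M N (f : {linear L -> M}) (g : {linear M -> N}),
    short_exact f g -> X L -> X N -> X M;
  resolving_kernel : forall L M N (f : {linear L -> M}) (g : {linear M -> N}),
    short_exact f g -> X M -> X N -> X L }.

Definition countably_many_indecomposables (X : lmodType R -> Prop) : Prop :=
  exists E : nat -> lmodType R,
    forall M, X M -> indecomposable M -> exists n, iso_module M (E n).

End Modules.

Record spec (R : comNzRingType) := Spec {
  spec_pred : R -> bool;
  spec_idealr : idealr_closed spec_pred;
  spec_prime : prime_idealr_closed spec_pred }.

HB.instance Definition _ (R : comNzRingType) (p : spec R) :=
  isIdealr.Build R (spec_pred p) (spec_idealr p).
HB.instance Definition _ (R : comNzRingType) (p : spec R) :=
  isPrimeIdealrClosed.Build R (spec_pred p) (@spec_prime R p).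

Coercion spec_prime_idealr (R : comNzRingType) (p : spec R) : prime_idealr R :=
  spec_pred p.

(* The supremum of the empty set is -oo; every other supremum in [\bar int]    *)
(* exists, so that [supremum] never uses its default value.                    *)
Lemma ereal_int_supremums (A : set (\bar int)) : supremums A !=set0.
Proof.
have [[N ubN]|noub] := pselect (exists N : int, ubound A N%:E); last first.
  exists +oo%E; split; first by move=> x _; exact: leey.
  move=> [z||] ub //; first by case: noub; exists z.
  by case: noub; exists 0; move=> x /ub; case: x => // ?; rewrite leNye.
have [[a Aa]|noint] := pselect (exists a : int, A a%:E); last first.
  exists -oo%E; split; last by move=> x _; exact: leNye.
  move=> [z||] // Az; first by case: noint; exists z.
  by have := ubN _ Az.
have exk : exists k : nat, `[< ubound A (a + k%:Z)%:E >].
  have := ubN _ Aa; rewrite lee_fin => aN.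
  exists `|N - a|%N; apply/asboolP; suff -> : a + `|N - a|%N%:Z = N by [].
  lia.
case: (ex_minnP exk) => k /asboolP ubk mink.
exists (a + k%:Z)%:E; split=> // -[z||] ubz; last by have := ubz _ Aa.
  have := ubz _ Aa; rewrite lee_fin => az.
  have /mink : `[< ubound A (a + `|z - a|%N%:Z)%:E >].
    apply/asboolP; suff -> : a + `|z - a|%N%:Z = z by [].
    lia.
  by rewrite lee_fin; lia.
exact: leey.
Qed.

Lemma supremum_le (A : set (\bar int)) (b : \bar int) :
  (supremum -oo%E A <= b)%E <-> (forall x, A x -> (x <= b)%E).
Proof.
rewrite /supremum; case: ifPn => [/eqP ->|A0]; first by rewrite leNye; split.
case: xgetP => [y _ [ub lub]|/(_ _) no]; last by have [x /no] := ereal_int_supremums A.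
split=> [yb x /ub xy|h]; [exact: le_trans xy yb|exact: lub].
Qed.

Section Locus.
Variable R : comNzRingType.

Definition nonfree_locus (M : lmodType R) : set (spec R) :=
  [set p : spec R | ~ free_module (localize p M : lmodType (locring p))].

Definition nonfree_locus_of (X : lmodType R -> Prop) : set (spec R) :=
  [set p : spec R | exists2 M, X M & nonfree_locus M p].

Definition prime_chain (n : nat) (q : nat -> spec R) : Prop :=
  forall i, (i < n)%N ->
    {subset q i <= q i.+1} /\ exists2 x, x \in q i.+1 & x \notin q i.

Definition krull_dim : \bar int :=
  supremum -oo%E [set (n%:Z)%:E | n in [set n | exists q, prime_chain n q]].

End Locus.

Definition dim_locus (R : comNzRingType) (Z : set (spec R)) : \bar int :=
  supremum -oo%E [set krull_dim {ideal_quot p} | p in Z].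

Lemma dim_locus_le (R : comNzRingType) (Z : set (spec R)) (d : nat) :
  (dim_locus Z <= (d%:Z)%:E)%E <->
  forall p, Z p -> forall n (q : nat -> spec {ideal_quot p}),
    prime_chain n q -> (n <= d)%N.
Proof.
rewrite supremum_le; split.
  move=> h p Zp n q c; have /supremum_le := h _ (ex_intro2 _ _ p Zp erefl).
  by move=> /(_ (n%:Z)%:E); rewrite lee_fin lez_nat; apply; exists n => //; exists q.
move=> h _ [p Zp <-]; apply/supremum_le => _ [n [q c] <-].
by rewrite lee_fin lez_nat; exact: h c.
Qed.

Section LocalRings.
Variable R : comNzRingType.

Definition noetherian : Prop :=
  forall I : idealr R, exists n (v : 'I_n -> R),
    (forall i, v i \in I) /\
    forall x, x \in I -> exists c : 'I_n -> R, x = \sum_i c i * v i.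

Definition maximal_ideal (m : idealr R) : Prop :=
  forall I : idealr R, {subset m <= I} -> {subset I <= m}.

Definition local_with (m : idealr R) : Prop :=
  forall I : idealr R, maximal_ideal I <-> I =i m.

Definition ideal_pow (m : idealr R) (n : nat) : set R :=
  [set x | exists k (c : 'I_k -> R) (a : 'I_k -> 'I_n -> R),
     (forall i j, a i j \in m) /\ x = \sum_i c i * \prod_j a i j].

(* The canonical map from R to the inverse limit of the R/m^n is bijective: an *)
(* element of the limit is given by representatives [x n] of its components.   *)
Definition complete_at (m : idealr R) : Prop :=
  (forall y, (forall n, ideal_pow m n y) -> y = 0) /\
  (forall x : nat -> R, (forall n, ideal_pow m n (x n.+1 - x n)) ->
     exists y, forall n, ideal_pow m n (y - x n)).

End LocalRings.

(* Main.v *)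
(* Let I_M be the ideal of those s for which multiplication by s on M factors  *)
(* through a projective module. The nonfree locus of M lies in V(I_M), and, as *)
(* long as M stays in X, I_M can be enlarged at will: pulling back a free      *)
(* cover of M along multiplication by x gives an extension N of M in X with    *)
(* x in I_N, I_M <= I_N and I_N <= rad (I_M + (x)). So every prime P >= I_M is *)
(* I_N for some N in X, hence I_L for an indecomposable summand L of N since   *)
(* I_(A * B) is the intersection of I_A and I_B. Only countably many primes    *)
(* arise in this way. If such a P began a chain P < Q1 < Q2, countable         *)
(* prime avoidance would give x in the maximal ideal lying in no nonmaximal    *)
(* prime above P, contradicting Krull's principal ideal theorem in R/P.        *)

(* Here [stable_ann M] is I_M. If some s outside p lies in I_M, multiplication by s factors through
   a free cover of M, which gives a dual basis of M up to the factor s; one of minimal length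
   becomes a basis of M_p ([locally_free]). For the pullback N along x, with K the kernel of the
   cover, an s in I_N yields an endomorphism phi of K such that s - x phi extends to the cover; as
   phi is integral over R, a power of s lies in I_M + (x) ([pullback_stable_ann_sub]). Adjoining the
   generators of a prime one by one gives [resolving_prime_stable_ann], and
   [resolving_indecomposable] passes to a summand by induction on the number of generators.

   Completeness and uncountability enter through prime avoidance. In the complete case this is
   Baire's argument, primes being closed by Krull's intersection theorem ([prime_closed]). In the
   other case some prime would contain infinitely many points of a polynomial curve whose
   coefficients generate m. The contradiction comes from [height_le1]. *)
From HB Require Import structures.
Require Import Defs.
From mathcomp Require Import all_boot all_order all_algebra finmap.
From mathcomp Require Import generic_quotient ring_quotient ring zify.
From mathcomp Require Import boolp classical_sets cardinality constructive_ereal.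

Set Implicit Arguments.
Unset Strict Implicit.
Unset Printing Implicit Defensive.

Import Order.TTheory GRing.Theory Num.Theory.

Local Open Scope ring_scope.
Local Open Scope quotient_scope.
Local Open Scope classical_set_scope.

(** * Ideals, Nakayama's lemma and the principal ideal theorem *)

Section Ideals.
Variable R : comNzRingType.
Implicit Types (I J K P Q : set R) (a b r s t x y z : R).

Definition submod (V : lmodType R) (Z : set V) : Prop :=
  [/\ Z 0, forall u v, Z u -> Z v -> Z (u + v) & forall r v, Z v -> Z (r *: v)].

Definition ideal I : Prop := submod (I : set R^o).

Definition prime_set P : Prop :=
  [/\ ideal P, ~ P 1 & forall a b, P (a * b) -> P a \/ P b].

Lemma idealP I :
  I 0 -> (forall a b, I a -> I b -> I (a + b)) -> (forall r a, I a -> I (r * a)) ->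
  ideal I.
Proof. by []. Qed.

Section Submod.
Variables (V : lmodType R) (Z : set V).
Hypothesis sZ : submod Z.

Lemma submod0 : Z 0. Proof. by case: sZ. Qed.
Lemma submodD u v : Z u -> Z v -> Z (u + v). Proof. by case: sZ => _ h _; apply: h. Qed.
Lemma submodZ r v : Z v -> Z (r *: v). Proof. by case: sZ => _ _ h; apply: h. Qed.
Lemma submodN v : Z v -> Z (- v).
Proof. by move=> Zv; rewrite -scaleN1r; apply: submodZ. Qed.
Lemma submodB u v : Z u -> Z v -> Z (u - v).
Proof. by move=> Zu Zv; apply: submodD => //; apply: submodN. Qed.
Lemma submod_sum k (v : 'I_k -> V) : (forall i, Z (v i)) -> Z (\sum_i v i).
Proof.
move=> h; elim/big_ind: _ => //; [exact: submod0|by move=> *; apply: submodD].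
Qed.
End Submod.

Section IdealOps.
Variable I : set R.
Hypothesis iI : ideal I.
Lemma ideal0 : I 0. Proof. exact: submod0 iI. Qed.
Lemma idealD a b : I a -> I b -> I (a + b). Proof. exact: (submodD iI). Qed.
Lemma idealN a : I a -> I (- a). Proof. exact: (submodN iI). Qed.
Lemma idealB a b : I a -> I b -> I (a - b). Proof. exact: (submodB iI). Qed.
Lemma ideal_mull r a : I a -> I (r * a). Proof. exact: (submodZ iI). Qed.
Lemma ideal_mulr r a : I a -> I (a * r). Proof. by rewrite mulrC; apply: ideal_mull. Qed.
Lemma ideal_sum k (v : 'I_k -> R) : (forall i, I (v i)) -> I (\sum_i v i).
Proof. exact: (submod_sum iI). Qed.
End IdealOps.

Lemma prime_ideal P : prime_set P -> ideal P. Proof. by case. Qed.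

Lemma primeM P a b : prime_set P -> ~ P a -> ~ P b -> ~ P (a * b).
Proof. by case=> _ _ h na nb /h[]. Qed.

Lemma primeX P a n : prime_set P -> P (a ^+ n) -> P a.
Proof.
move=> pP; elim: n => [|n IH]; first by rewrite expr0; case: pP.
by rewrite exprS => h; case: pP => _ _ /(_ _ _ h)[|/IH].
Qed.

Lemma prime_prod P (n : nat) (D : pred 'I_n) (F : 'I_n -> R) : prime_set P ->
  (forall i, D i -> ~ P (F i)) -> ~ P (\prod_(i | D i) F i).
Proof.
move=> pP h; elim/big_ind: _ => //; first by case: pP.
by move=> a b; apply: primeM.
Qed.

(* Nakayama's lemma for the localization at [P], before inverting anything.   *)
Lemma prime_nakayama P (V : lmodType R) (Z : set V) k (v : 'I_k -> V)
    (t : 'I_k -> R) (b : 'I_k -> 'I_k -> R) :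
  prime_set P -> submod Z -> (forall i, ~ P (t i)) -> (forall i j, P (b i j)) ->
  (forall i, Z (t i *: v i - \sum_j b i j *: v j)) ->
  exists2 s, ~ P s & forall i, Z (s *: v i).
Proof.
move=> pP sZ; have iP := prime_ideal pP.
elim: k v t b => [|k IH] v t b nt Pb h.
  by exists 1 => [|[]]; case: pP.
set w := widen_ord (leqnSn k); set l := @ord_max k.
(* Gaussian elimination without division: [u], the coefficient of [v l] in its own relation, stays
   outside [P], so scaling the other relations by [u] lets that relation remove [v l] from them. *)
pose u := t l - b l l.
have nu : ~ P u.
  by move=> Pu; apply: (nt l); rewrite -[t l](subrK (b l l)); apply: (idealD iP).
have Zl : Z (u *: v l - \sum_j b l (w j) *: v (w j)).
  have := h l; rewrite big_ord_recr /= -/l.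
  by rewrite opprD addrA addrAC -scalerBl.
have [i|i j|i|s ns Zs] := IH (v \o w) (fun i => u * t (w i))
    (fun i j => u * b (w i) (w j) + b (w i) l * b l (w j)).
- exact: primeM.
- by apply: (idealD iP); [apply: (ideal_mull iP)|apply: (ideal_mulr iP)].
- suff -> : (u * t (w i)) *: v (w i)
       - \sum_j (u * b (w i) (w j) + b (w i) l * b l (w j)) *: v (w j)
     = u *: (t (w i) *: v (w i) - \sum_j b (w i) j *: v j)
       + b (w i) l *: (u *: v l - \sum_j b l (w j) *: v (w j)).
    by apply: (submodD sZ); apply: (submodZ sZ).
  have -> : \sum_j (u * b (w i) (w j) + b (w i) l * b l (w j)) *: v (w j)
     = u *: (\sum_j b (w i) (w j) *: v (w j))
       + b (w i) l *: (\sum_j b l (w j) *: v (w j)).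
    rewrite !scaler_sumr -big_split; apply: eq_bigr => j _.
    by rewrite scalerDl !scalerA.
  rewrite big_ord_recr /= -/l !scalerBr scalerDr !scalerA (mulrC _ u).
  by rewrite !opprD !addrA subrK.
exists (s * u); first exact: primeM.
have Zl' : Z ((s * u) *: v l).
  rewrite -scalerA.
  rewrite -[u *: v l](subrK (\sum_j b l (w j) *: v (w j))) scalerDr.
  apply: (submodD sZ); first exact: submodZ.
  rewrite scaler_sumr; apply: submod_sum => // j.
  rewrite scalerA mulrC -scalerA; apply: (submodZ sZ); exact: Zs.
move=> i; case: (unliftP l i) => [j ->|->] //.
have -> : lift l j = w j by apply: val_inj; rewrite /= /bump leqNgt ltn_ord.
by rewrite mulrC -scalerA; apply: (submodZ sZ); apply: Zs.
Qed.

Definition adjoin I a : set R := [set y | exists z r, I z /\ y = z + r * a].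

Lemma adjoin_ideal I a : ideal I -> ideal (adjoin I a).
Proof.
move=> iI; apply: idealP.
- by exists 0, 0; rewrite mul0r addr0; split=> //; apply: ideal0.
- move=> _ _ [z [r [Iz ->]]] [z' [r' [Iz' ->]]]; exists (z + z'), (r + r').
  by split; [apply: (idealD iI)|ring].
- move=> s _ [z [r [Iz ->]]]; exists (s * z), (s * r).
  by split; [apply: (ideal_mull iI)|ring].
Qed.

Lemma adjoin_sub I a : I `<=` adjoin I a.
Proof. by move=> z Iz; exists z, 0; rewrite mul0r addr0. Qed.

Lemma adjoin_gen I a : ideal I -> adjoin I a a.
Proof. by move=> iI; exists 0, 1; rewrite mul1r add0r; split=> //; apply: ideal0. Qed.

Lemma adjoin_min I J a : ideal J -> I `<=` J -> J a -> adjoin I a `<=` J.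
Proof.
move=> iJ IJ Ja _ [z [r [/IJ Jz ->]]]; apply: (idealD iJ) => //.
exact: (ideal_mull iJ).
Qed.

Definition colon I a : set R := [set y | I (y * a)].

Lemma colon_ideal I a : ideal I -> ideal (colon I a).
Proof.
move=> iI; apply: idealP; rewrite /colon /=.
- by rewrite mul0r; apply: ideal0.
- by move=> y z Iy Iz; rewrite mulrDl; apply: idealD.
- by move=> r y Iy; rewrite -mulrA; apply: ideal_mull.
Qed.

Lemma colon_sub I a : ideal I -> I `<=` colon I a.
Proof. by move=> iI y Iy; apply: (ideal_mulr iI). Qed.

Definition isum I J : set R := [set y | exists a b, [/\ I a, J b & y = a + b]].

Lemma isum_ideal I J : ideal I -> ideal J -> ideal (isum I J).
Proof.
move=> iI iJ; apply: idealP.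
- by exists 0, 0; split; rewrite ?addr0 //; apply: ideal0.
- move=> _ _ [a [b [Ia Jb ->]]] [a' [b' [Ia' Jb' ->]]].
  exists (a + a'), (b + b'); split; [exact: (idealD iI)|exact: (idealD iJ)|ring].
- move=> r _ [a [b [Ia Jb ->]]]; exists (r * a), (r * b).
  by split; [exact: (ideal_mull iI)|exact: (ideal_mull iJ)|ring].
Qed.

Lemma isum_subl I J : ideal J -> I `<=` isum I J.
Proof. by move=> iJ a Ia; exists a, 0; split; rewrite ?addr0 //; apply: ideal0. Qed.

Lemma isum_subr I J : ideal I -> J `<=` isum I J.
Proof. by move=> iI a Ia; exists 0, a; split; rewrite ?add0r //; apply: ideal0. Qed.

Definition iprod I J : set R :=
  [set y | exists k (a b : 'I_k -> R),
     [/\ forall i, I (a i), forall i, J (b i) & y = \sum_i a i * b i]].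

Lemma iprod_ideal I J : ideal I -> ideal J -> ideal (iprod I J).
Proof.
move=> iI iJ; apply: idealP.
- by exists 0%N, (fun=> 0), (fun=> 0); rewrite big_ord0; split=> // -[].
- move=> _ _ [k [a [b [Ia Jb ->]]]] [l [c [d [Ic Jd ->]]]].
  exists (k + l)%N, (fun i => match split i with inl i => a i | inr i => c i end),
   (fun i => match split i with inl i => b i | inr i => d i end); split.
  + by move=> i; case: (split i).
  + by move=> i; case: (split i).
  rewrite big_split_ord /=; congr (_ + _); apply: eq_bigr => i _.
    by rewrite (unsplitK (inl i)).
  by rewrite (unsplitK (inr i)).
- move=> r _ [k [a [b [Ia Jb ->]]]]; exists k, (fun i => r * a i), b.
  split=> //; first by move=> i; apply: (ideal_mull iI).
  by rewrite mulr_sumr; apply: eq_bigr => i _; rewrite mulrA.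
Qed.

Lemma iprod_mul I J a b : I a -> J b -> iprod I J (a * b).
Proof.
by move=> Ia Jb; exists 1%N, (fun=> a), (fun=> b); rewrite big_ord1.
Qed.

(** Puts membership in a product into the form that [prime_nakayama] takes, with coefficients in a
    prime. *)
Lemma iprod_gens I J k (v : 'I_k -> R) y : ideal I ->
  (forall x, J x -> exists c : 'I_k -> R, x = \sum_i c i * v i) ->
  iprod I J y -> exists2 c : 'I_k -> R, forall i, I (c i) & y = \sum_i c i * v i.
Proof.
move=> iI gen [l [a [b [Ia Jb ->]]]].
have /choice[c cE] i : exists c : 'I_k -> R, b i = \sum_j c j * v j by apply: gen.
exists (fun j => \sum_i a i * c i j).
  by move=> j; apply: (ideal_sum iI) => i; apply: (ideal_mulr iI).
under eq_bigr => i _ do rewrite cE mulr_sumr.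
rewrite exchange_big /=; apply: eq_bigr => j _; rewrite mulr_suml.
by apply: eq_bigr => i _; rewrite mulrA.
Qed.

End Ideals.

Section Noetherian.
Variable R : comNzRingType.
Hypothesis noethR : noetherian R.
Implicit Types (I J K P Q : set R) (a b r s t x y z : R).

(** Bridges the sets used here, which may be the unit ideal, and [idealr], whose members are boolean
    and proper. *)
Lemma idealr_of I : ideal I -> ~ I 1 ->
  exists I' : idealr R, forall x, (x \in I') = `[< I x >].
Proof.
move=> iI nI1.
have cl : idealr_closed (fun x => `[< I x >] : bool).
  split; rewrite ?unfold_in; first exact/asboolP/(ideal0 iI).
    exact/asboolPn.
  move=> a u v; rewrite !unfold_in => /asboolP Iu /asboolP Iv; apply/asboolP.
  by apply: (idealD iI) => //; apply: (ideal_mull iI).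
pose H := isIdealr.Build R (fun x => `[< I x >] : bool) cl.
pose I' : idealr R := HB.pack (fun x : R => `[< I x >] : bool) H.
by exists I'.
Qed.

Lemma ideal_of_idealr (I : idealr R) : ideal [set x | x \in I].
Proof.
apply: idealP => /=; first exact: idealr0.
  by move=> a b Ia Ib; rewrite rpredD.
by move=> r a Ia; apply: idealMr.
Qed.

Lemma ideal_fg I : ideal I -> exists k (v : 'I_k -> R), (forall i, I (v i)) /\
  forall x, I x -> exists c : 'I_k -> R, x = \sum_i c i * v i.
Proof.
move=> iI; case: (pselect (I 1)) => [I1|nI1].
  exists 1%N, (fun=> 1); split=> // x _; exists (fun=> x).
  by rewrite big_ord1 mulr1.
have [I' E] := idealr_of iI nI1.
have [k [v [Iv gen]]] := noethR I'; exists k, v; split.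
  by move=> i; have := Iv i; rewrite E => /asboolP.
by move=> x Ix; apply: gen; rewrite E; apply/asboolP.
Qed.

Lemma ideal_chain_stable (c : nat -> set R) :
  (forall n, ideal (c n)) -> (forall n, c n `<=` c n.+1) ->
  exists n, c n.+1 `<=` c n.
Proof.
move=> ic mon.
have monD n d : c n `<=` c (n + d)%N.
  elim: d => [|d IH]; rewrite ?addn0 // addnS => x /IH; exact: mon.
have mon' n n' : (n <= n')%N -> c n `<=` c n' by move=> /subnKC <-.
pose U : set R := [set x | exists n, c n x].
have iU : ideal U.
  apply: idealP; first by exists 0%N; apply: ideal0.
    move=> a b [n ca] [n' cb]; exists (maxn n n'); apply: (idealD (ic _)).
      by apply: mon' ca; rewrite leq_maxl.
    by apply: mon' cb; rewrite leq_maxr.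
  by move=> r a [n ca]; exists n; apply: (ideal_mull (ic _)).
have [k [v [Uv gen]]] := ideal_fg iU.
have /choice[N cN] : forall i, exists n, c n (v i) by [].
exists (\max_i N i)%N => x cx.
have [|d ->] := gen x; first by exists (\max_i N i).+1.
apply: (ideal_sum (ic _)) => i; apply: (ideal_mull (ic _)).
by apply: mon' (cN i); apply: leq_bigmax.
Qed.

Lemma noeth_max (S : set R -> Prop) I : ideal I -> S I ->
  exists K, [/\ ideal K, S K, I `<=` K &
    forall J, ideal J -> S J -> K `<=` J -> J `<=` K].
Proof.
move=> iI SI; apply: contrapT => nomax.
pose T := {K : set R | [/\ ideal K, S K & I `<=` K]}.
have nxt (K : T) : {J : T | sval K `<=` sval J /\ ~ sval J `<=` sval K}.
  apply: cid; case: K => K [iK SK IK] /=; apply: contrapT => nJ.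
  apply: nomax; exists K; split=> // J iJ SJ KJ; apply: contrapT => nJK.
  have TJ : [/\ ideal J, S J & I `<=` J] by split=> //; apply: subset_trans KJ.
  by apply: nJ; exists (exist _ J TJ).
have TI : [/\ ideal I, S I & I `<=` I] by split; last exact: subset_refl.
have [f [_ fS]] := dependent_choice nxt (exist _ I TI).
have [n|n|n] := @ideal_chain_stable (fun n => sval (f n)).
- by case: (svalP (f n)).
- by case: (fS n).
- by case: (fS n).
Qed.

Lemma noeth_ind (S : set R -> Prop) :
  (forall I, ideal I ->
     (forall J, ideal J -> I `<=` J -> ~ J `<=` I -> S J) -> S I) ->
  forall I, ideal I -> S I.
Proof.
move=> step I iI; apply: contrapT => nSI.
have [K [iK nSK _ Kmax]] := @noeth_max (fun K => ~ S K) I iI nSI.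
apply: nSK; apply: step => // J iJ KJ nJK; apply: contrapT => nSJ.
exact/nJK/Kmax.
Qed.

(* An annihilator of a nonzero element of [R/J], maximal as such, is prime.     *)
Lemma assoc_prime J : ideal J -> ~ J 1 -> exists2 a, ~ J a & prime_set (colon J a).
Proof.
move=> iJ nJ1.
pose S K := exists2 a, ~ J a & K = colon J a.
have SJ : S (colon J 1) by exists 1.
have [K [iK [a nJa ->] _ Kmax]] := noeth_max (colon_ideal 1 iJ) SJ.
exists a => //; split; first exact: colon_ideal.
  by rewrite /colon /= mul1r.
move=> b c bcP; case: (pselect (colon J a c)) => [|nc]; [by right|left].
apply: (Kmax (colon J (c * a))); first exact: colon_ideal.
- by exists (c * a).
- by move=> y Jy; rewrite /colon /= mulrCA; apply: (ideal_mull iJ).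
by rewrite /colon /= mulrA.
Qed.

Section Local.
Variable m : set R.
Hypothesis pm : prime_set m.
Hypothesis unit_m : forall x, ~ m x -> exists y, y * x = 1.

Lemma proper_sub_max I : ideal I -> ~ I 1 -> I `<=` m.
Proof.
move=> iI nI1 x Ix; apply: contrapT => /unit_m[y yx]; apply: nI1.
by rewrite -yx; apply: (ideal_mull iI).
Qed.

(* [R/J] is artinian: by noetherian induction, using the minimal ideal of [R/J] *)
(* generated by an element with annihilator [m].                               *)
Lemma dcc_over J : ideal J ->
  (forall Q, prime_set Q -> J `<=` Q -> m `<=` Q) ->
  forall c : nat -> set R, (forall n, ideal (c n)) ->
    (forall n, c n.+1 `<=` c n) -> (forall n, J `<=` c n) ->
  exists N, forall n, (N <= n)%N -> c N `<=` c n.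
Proof.
move: J; apply: noeth_ind => J iJ IH Jm c ic dec Jc.
have decD n d : c (n + d)%N `<=` c n.
  by elim: d => [|d IHd]; rewrite ?addn0 // addnS => x /dec; apply: IHd.
have dec' n n' : (n <= n')%N -> c n' `<=` c n by move=> /subnKC <-.
have [J1|nJ1] := pselect (J 1).
  by exists 0%N => n _ x _; rewrite -[x]mulr1; apply/(ideal_mull (ic n))/Jc.
have [a nJa pa] := assoc_prime iJ nJ1.
have ma : m `<=` colon J a by apply: Jm pa _; apply: colon_sub.
have [||||n|n|n|N hN] := IH (adjoin J a) _ _ _ _ (fun n => adjoin (c n) a).
- exact: adjoin_ideal.
- exact: adjoin_sub.
- by move=> h; apply: nJa; apply: h; apply: adjoin_gen.
- move=> Q pQ JQ; apply: Jm => //; apply: subset_trans JQ; exact: adjoin_sub.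
- exact: adjoin_ideal.
- move=> _ [z [r [cz ->]]]; exists z, r; split=> //; exact: dec cz.
- move=> _ [z [r [Jz ->]]]; exists z, r; split=> //; exact: Jc Jz.
have [alla|] := pselect (forall n, c n a).
  exists N => n Nn x cx; have : adjoin (c N) a x by apply: adjoin_sub.
  by move=> /(hN n Nn); apply: adjoin_min.
move=> /existsNP[N2 na]; exists (maxn N N2) => n; rewrite geq_max => /andP[Nn N2n].
move=> x cx; have : adjoin (c N) a x.
  by apply: adjoin_sub; apply: dec' cx; apply: leq_maxl.
move=> /(hN n Nn)[z [r [cz xE]]].
(* Since [a] is not in [c N2], a multiple [r * a] in it has [r] in [m]; but [m] kills [a] modulo
   [J], so the multiple lies in every term. *)
have cra : c N2 (r * a).
  have -> : r * a = x - z by rewrite xE; ring.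
  apply: (idealB (ic _)); first by apply: dec' cx; apply: leq_maxr.
  exact: dec' cz.
have mr : m r.
  apply: contrapT => /unit_m[y yr]; apply: na.
  by rewrite -[a]mul1r -yr -mulrA; apply: (ideal_mull (ic _)).
by rewrite xE; apply: (idealD (ic _)) => //; apply: Jc; apply: ma.
Qed.

(* Krull's principal ideal theorem for [R/Q0], via symbolic powers of [Q1].    *)
Lemma height_le1 Q0 Q1 x : prime_set Q0 -> prime_set Q1 -> Q0 `<=` Q1 -> m x ->
  (forall Q, prime_set Q -> Q0 `<=` Q -> Q x -> m `<=` Q) ->
  Q1 `<=` Q0 \/ m `<=` Q1.
Proof.
move=> p0 p1 Q01 mx xm.
have i0 := prime_ideal p0; have i1 := prime_ideal p1.
have [Q1x|nQ1x] := pselect (Q1 x); [by right; apply: xm|left].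
(* [sat I] is the contraction to [R] of [Q1 I + Q0] localized at [Q1], so [L n] below is the n-th
   symbolic power of [Q1] modulo [Q0]. *)
pose sat (I : set R) : set R :=
  [set a | exists2 t, ~ Q1 t & isum (iprod Q1 I) Q0 (t * a)].
have isat I : ideal I -> ideal (sat I).
  move=> iI; have iS := isum_ideal (iprod_ideal i1 iI) i0.
  apply: idealP.
  - exists 1; first by case: p1.
    by rewrite mulr0; apply: ideal0.
  - move=> a b [t nt ta] [u nu ub]; exists (t * u); first exact: primeM.
    have -> : t * u * (a + b) = u * (t * a) + t * (u * b) by ring.
    by apply: (idealD iS); apply: (ideal_mull iS).
  - move=> r a [t nt ta]; exists t => //; rewrite mulrCA.
    exact: (ideal_mull iS).
pose L n := iter n sat setT.
have iL n : ideal (L n).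
  by elim: n => [|n IH]; [apply: idealP|apply: isat].
have satmon I J : I `<=` J -> sat I `<=` sat J.
  move=> IJ a [t nt [b [d [bI dQ E]]]]; exists t => //; exists b, d; split=> //.
  by case: bI => k [f [g [? ? ->]]]; exists k, f, g; split=> // i; apply: IJ.
have Ldec n : L n.+1 `<=` L n.
  by elim: n => [|n IH]; [move=> x0 _|apply: satmon].
have Q0L n : Q0 `<=` L n.
  case: n => [|n] a Q0a //; exists 1; first by case: p1.
  by rewrite mul1r; apply: isum_subr => //; apply: iprod_ideal.
have Lsat n t a : ~ Q1 t -> L n (t * a) -> L n a.
  case: n => // n nt [u nu h]; exists (u * t); first exact: primeM.
  by rewrite -mulrA.
have Q1L n y : Q1 y -> L n (y ^+ n).
  move=> Qy; elim: n => // n IH; exists 1; first by case: p1.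
  rewrite mul1r exprS; apply: isum_subl => //; exact: iprod_mul.
have [|||||N hN] := @dcc_over (adjoin Q0 x) _ _ (fun n => adjoin (L n) x).
- exact: adjoin_ideal.
- move=> Q pQ Q0Q; apply: xm => //; first by apply: subset_trans Q0Q; apply: adjoin_sub.
  by apply: Q0Q; apply: adjoin_gen.
- by move=> n; apply: adjoin_ideal.
- by move=> n _ [z [r [Lz ->]]]; exists z, r; split=> //; apply: Ldec.
- by move=> n _ [z [r [Qz ->]]]; exists z, r; split=> //; apply: Q0L.
(* [L N + (x) = L N.+1 + (x)], and [x], being outside [Q1], cancels in [L N]; hence
   [L N = L N.+1 + x L N]. *)
have step a : L N a -> exists2 c, L N c & L N.+1 (a - x * c).
  move=> La; have : adjoin (L N) x a by apply: adjoin_sub.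
  move=> /(hN N.+1 (leqnSn N))[b [c [Lb aE]]]; exists c.
    apply: (Lsat _ x) => //; have -> : x * c = a - b by rewrite aE; ring.
    by apply: (idealB (iL _)) => //; apply: Ldec.
  by have -> : a - x * c = b by rewrite aE; ring.
have [k [v [Lv gen]]] := ideal_fg (iL N).
have /choice[c cP] i : exists c : 'I_k -> R, L N.+1 (v i - x * \sum_j c j * v j).
  by have [c /gen[d ->] h] := step _ (Lv i); exists d.
(* Nakayama at [m] gives [L N = L N.+1]. A second use, at [Q1] and modulo [Q0], puts [L N] inside
   [Q0], and with it the N-th powers of elements of [Q1]. *)
have LvS i : L N.+1 (v i).
  have [||i'|s ns /(_ i) Ls] :=
    @prime_nakayama R m R^o (L N.+1) k v (fun=> 1) (fun i j => x * c i j) pm (iL _).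
  - by case: pm.
  - by move=> i' j; apply: (ideal_mulr (prime_ideal pm)).
  - rewrite scale1r; congr (L N.+1 (_ - _)): (cP i').
    rewrite mulr_sumr; apply: eq_bigr => j _; exact: mulrA.
  apply: (Lsat _ s) => //; apply: contra_not ns.
  by apply: proper_sub_max => //; case: p1.
have /choice[t tP] i : exists t, ~ Q1 t /\ isum (iprod Q1 (L N)) Q0 (t * v i).
  by case: (LvS i) => t nt h; exists t.
have /choice[b bP] i : exists b : 'I_k -> R,
    (forall j, Q1 (b j)) /\ Q0 (t i * v i - \sum_j b j * v j).
  case: (tP i) => _ [y [z [/(iprod_gens i1 gen)[b Qb ->] Qz ->]]].
  by exists b; split=> //; rewrite addrC addKr.
have [i|i j|i|s ns Q0s] := @prime_nakayama R Q1 R^o Q0 k v t b p1 i0.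
- by case: (tP i).
- by case: (bP i).
- by case: (bP i).
have LQ0 : L N `<=` Q0.
  move=> y /gen[d ->]; apply: (ideal_sum i0) => i; apply: (ideal_mull i0).
  by case: p0 => _ _ /(_ s (v i) (Q0s i))[/Q01|].
by move=> y Q1y; apply: (primeX p0 (n := N)); apply: LQ0; apply: Q1L.
Qed.

End Local.
End Noetherian.

(** * Countable prime avoidance *)

Section LocalFacts.
Variables (R : comNzRingType) (m : idealr R).
Hypothesis noethR : noetherian R.
Hypothesis locR : local_with m.
Implicit Types (I J K P Q : set R) (a b r x y z : R).

Let M : set R := [set x | x \in m].

(** If [x] were not a unit, an ideal maximal among the proper ones containing it would be a maximal
    ideal, hence [m]. *)
Lemma local_unit x : ~ M x -> exists y, y * x = 1.
Proof.
move=> nMx; apply: contrapT => nu; apply: nMx.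
have i0 : ideal ([set 0] : set R).
  apply: idealP => //= [a b -> ->|r a ->]; by rewrite ?addr0 ?mulr0.
have pr : ~ adjoin [set 0] x 1.
  by move=> [_ [r [/= -> E]]]; apply: nu; exists r; rewrite E add0r.
have [K [iK nK1 xK Kmax]] :=
  @noeth_max _ noethR (fun K => ~ K 1) _ (adjoin_ideal x i0) pr.
have [K' K'E] := idealr_of iK nK1.
have maxK : maximal_ideal K'.
  move=> I KI y Iy; rewrite K'E; apply/asboolP.
  apply: (Kmax [set x | x \in I]) => //=; first exact: ideal_of_idealr.
    by rewrite idealr1.
  by move=> z Kz; apply: KI; rewrite K'E; apply/asboolP.
have /locR /(_ x) := maxK; rewrite K'E /M /= => <-; apply/asboolP.
by apply: xK; apply: adjoin_gen.
Qed.

Lemma local_prime : prime_set M.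
Proof.
split; [exact: ideal_of_idealr|by rewrite /M /= idealr1|move=> a b Mab].
have [|/local_unit[y ya]] := pselect (M a); [by left|right].
rewrite -[b]mul1r -ya -mulrA; exact: (ideal_mull (ideal_of_idealr m)).
Qed.

Lemma ideal_pow_ideal n : ideal (ideal_pow m n).
Proof.
apply: idealP.
- by exists 0%N, (fun=> 0), (fun=> fun=> 0); split=> [[]|] //; rewrite big_ord0.
- move=> _ _ [k [c [a [ma ->]]]] [l [d [b [mb ->]]]].
  exists (k + l)%N, (fun i => match split i with inl i => c i | inr i => d i end),
   (fun i => match split i with inl i => a i | inr i => b i end); split.
    by move=> i j; case: (split i).
  rewrite big_split_ord /=; congr (_ + _); apply: eq_bigr => i _.
    by rewrite (unsplitK (inl i)).
  by rewrite (unsplitK (inr i)).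
- move=> r _ [k [c [a [ma ->]]]]; exists k, (fun i => r * c i), a; split=> //.
  by rewrite mulr_sumr; apply: eq_bigr => i _; rewrite mulrA.
Qed.

Lemma ideal_powX n x : M x -> ideal_pow m n (x ^+ n).
Proof.
move=> mx; exists 1%N, (fun=> 1), (fun=> fun=> x); split=> //.
by rewrite big_ord1 mul1r prodr_const card_ord.
Qed.

Lemma ideal_pow_min n I : ideal I ->
  (forall a : 'I_n -> R, (forall j, M (a j)) -> I (\prod_j a j)) ->
  ideal_pow m n `<=` I.
Proof.
move=> iI h _ [k [c [a [ma ->]]]]; apply: (ideal_sum iI) => i.
by apply: (ideal_mull iI); apply: h; apply: ma.
Qed.

Lemma ideal_pow_dec n n' : (n <= n')%N -> ideal_pow m n' `<=` ideal_pow m n.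
Proof.
move=> /subnKC <-; elim: (n' - n)%N => [|d IH]; first by rewrite addn0.
apply: subset_trans IH; rewrite addnS; apply: ideal_pow_min.
  exact: ideal_pow_ideal.
move=> a ma; rewrite big_ord_recl; apply: (ideal_mull (ideal_pow_ideal _)).
exists 1%N, (fun=> 1), (fun=> fun j => a (lift ord0 j)); split=> //.
  by move=> _ j; apply: ma.
by rewrite big_ord1 mul1r.
Qed.

Lemma ideal_pow1 : ideal_pow m 1 `<=` M.
Proof.
apply: ideal_pow_min; first exact: ideal_of_idealr.
by move=> a ma; rewrite big_ord1.
Qed.

(** Noetherian induction. Choose z in [M] outside [K] and s with [z ^+ s.+1] but not [z ^+ s] in
    [K]: then [K + (z ^+ s)] and [K : z ^+ s] are both strictly larger than [K], and their product
    lies in [K]. *)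
Lemma prods_in_of_nilpotent K : ideal K ->
  (forall z, M z -> exists s, K (z ^+ s)) ->
  exists t, forall s : seq R, size s = t -> (forall x, x \in s -> M x) ->
    K (\prod_(x <- s) x).
Proof.
move: K; apply: (noeth_ind noethR) => K iK IH nil.
have [MK|] := pselect (M `<=` K).
  exists 1%N => -[|x [|]] //= _ h; rewrite big_seq1; apply: MK; apply: h.
  by rewrite inE.
move=> /existsNP[z /not_implyP[Mz nKz]].
have exs : exists s, `[< K (z ^+ s) >].
  by case: (nil z Mz) => s ?; exists s; apply/asboolP.
case: (ex_minnP exs) => -[|s] /asboolP Kz mins.
  exists 0%N => -[|//] _ _; by rewrite big_nil.
have nKs : ~ K (z ^+ s) by move=> /asboolP /mins; rewrite ltnn.
have nil' J : K `<=` J -> forall z, M z -> exists s, J (z ^+ s).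
  by move=> KJ y /nil[n /KJ ?]; exists n.
have [||n hn|t ht] := IH (adjoin K (z ^+ s)) (adjoin_ideal _ iK).
- exact: adjoin_sub.
- by move=> h; apply: nKs; apply: h; apply: adjoin_gen.
- by apply: nil' => //; apply: adjoin_sub.
have [||n hn|t' ht'] := IH (colon K (z ^+ s)) (colon_ideal _ iK).
- exact: colon_sub.
- by move=> h; apply: nKz; apply: h; rewrite /colon /= -exprS.
- by apply: nil' => //; apply: colon_sub.
exists (t + t')%N => l sl Ml; rewrite -(cat_take_drop t l) big_cat /=.
have [||k [r [Kk ->]]] := ht (take t l).
- by rewrite size_takel // sl leq_addr.
- by move=> x /mem_take; apply: Ml.
have : colon K (z ^+ s) (\prod_(x <- drop t l) x).
  apply: ht'; first by rewrite size_drop sl addKn.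
  by move=> x /mem_drop; apply: Ml.
rewrite /colon /=; set d := \prod_(x <- _) x => Kd.
have -> : (k + r * z ^+ s) * d = d * k + r * (d * z ^+ s) by ring.
by apply: (idealD iK); apply: (ideal_mull iK).
Qed.

(* Krull's intersection theorem for [R/P].                                    *)
Lemma prime_closed P a : prime_set P ->
  (forall n, exists2 b, P b & ideal_pow m n (a - b)) -> P a.
Proof.
move=> pP; have iP := prime_ideal pP; have pM := local_prime.
have iM := prime_ideal pM.
have PM : P `<=` M by apply: (proper_sub_max local_unit) => //; case: pP.
pose N : set R := [set a | forall n, exists2 b, P b & ideal_pow m n (a - b)].
have iN : ideal N.
  apply: idealP.
  - by move=> n; exists 0; rewrite ?subr0; apply: ideal0 => //; apply: ideal_pow_ideal.
  - move=> x y Nx Ny n; case: (Nx n) => b Pb xb; case: (Ny n) => c Pc yc.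
    exists (b + c); first exact: idealD.
    have -> : x + y - (b + c) = (x - b) + (y - c) by ring.
    exact: (idealD (ideal_pow_ideal n)).
  - move=> r x Nx n; case: (Nx n) => b Pb xb; exists (r * b).
      exact: ideal_mull.
    rewrite -mulrBr; exact: (ideal_mull (ideal_pow_ideal n)).
suff : N `<=` P by apply.
(* It suffices that [N] is contained in [P + m N]. Take [K] maximal among the   *)
(* ideals above [P + m N] with the same intersection with [N]: it contains a    *)
(* power of [m], hence [N].                                                     *)
pose I := isum P (iprod M N).
have iI : ideal I by apply: isum_ideal => //; apply: iprod_ideal.
have [K [iK SK IK Kmax]] :=
  @noeth_max _ noethR (fun K => forall y, K y -> N y -> I y) I iI (fun y Iy _ => Iy).
have MNK x y : M x -> N y -> K (x * y).
  by move=> Mx Ny; apply: IK; apply: isum_subr => //; apply: iprod_mul.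
have [|t ht] := prods_in_of_nilpotent iK.
  (* If [k + r * z ^+ s] lies in [N], multiplying by z lands in [M N], so [r * z ^+ s.+1] is in [K];
     once the colon ideals are stable, [r * z ^+ s] is too. Maximality of [K] then gives [z ^+ s] in
     [K]. *)
  move=> z Mz; have [n|n y|s hs] :=
    @ideal_chain_stable _ noethR (fun s => colon K (z ^+ s)).
  - exact: colon_ideal.
  - by rewrite /colon /= exprS mulrCA => Ky; apply: (ideal_mull iK).
  exists s; apply: (Kmax (adjoin K (z ^+ s))); last 2 first.
  - exact: adjoin_sub.
  - exact: adjoin_gen.
  - exact: adjoin_ideal.
  move=> _ [k [r [Kk ->]]] Ny; apply: SK => //; apply: (idealD iK) => //.
  apply: hs; rewrite /colon /= exprS.
  have -> : r * (z * z ^+ s) = z * (k + r * z ^+ s) - z * k by ring.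
  by apply: (idealB iK); [apply: MNK|apply: (ideal_mull iK)].
have powK : ideal_pow m t `<=` K.
  apply: ideal_pow_min => // c Mc.
  have -> : \prod_j c j = \prod_(x <- [seq c j | j <- enum 'I_t]) x.
    by rewrite big_map big_enum.
  apply: ht; first by rewrite size_map size_enum_ord.
  by move=> _ /mapP[j _ ->].
have NI : N `<=` I.
  move=> y Ny; apply: SK => //; case: (Ny t) => b Pb yb; rewrite -(subrK b y).
  apply: (idealD iK); first exact: powK.
  by apply: IK; apply: isum_subl => //; apply: iprod_ideal.
have [k [v [Nv gen]]] := ideal_fg noethR iN.
have /choice[c cP] i : exists c : 'I_k -> R,
    (forall j, M (c j)) /\ P (v i - \sum_j c j * v j).
  case: (NI _ (Nv i)) => b [y [Pb /(iprod_gens iM gen)[c Mc ->] ->]].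
  by exists c; split=> //; rewrite addrK.
have [i|i j|i|s nMs Ps] := @prime_nakayama R M R^o P k v (fun=> 1) c pM iP.
- by case: pM.
- by case: (cP i).
- by rewrite scale1r; case: (cP i).
move=> y /gen[d ->]; apply: (ideal_sum iP) => i; apply: (ideal_mull iP).
by case: pP => _ _ /(_ _ _ (Ps i))[/PM|].
Qed.

Section Avoidance.
Variable P : nat -> set R.
Hypothesis primeP : forall i, prime_set (P i).
Hypothesis MP : forall i, ~ M `<=` P i.

(* Baire category: each prime is closed and nowhere dense in [m].             *)
Lemma complete_prime_avoidance : complete_at m ->
  exists2 x, M x & forall i, ~ P i x.
Proof.
move=> [_ compl].
(* A state holds an approximation, its precision, and the index of the next prime to avoid; the
   whole ball of the next state misses that prime. *)
pose T := (R * nat * nat)%type.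
pose next (u v : T) := [/\ v.2 = u.2.+1, (u.1.2 < v.1.2)%N,
  ideal_pow m u.1.2 (v.1.1 - u.1.1) &
  forall y, ideal_pow m v.1.2 (y - v.1.1) -> ~ P u.2 y].
have nextP u : {v : T | next u v}.
  apply: cid; case: u => -[x k] i.
  have [x' xx' nPx'] : exists2 x', ideal_pow m k (x' - x) & ~ P i x'.
    have [Px|] := pselect (P i x); last first.
      by exists x => //; rewrite subrr; apply: ideal0; apply: ideal_pow_ideal.
    have /existsNP[u /not_implyP[Mu nPu]] := MP (i := i).
    exists (x + u ^+ k); first by rewrite addrC addKr; apply: ideal_powX.
    move=> Pxu; apply: nPu; apply: (primeX (primeP i) (n := k)).
    by rewrite -(addKr x (_ ^+ _)) addrC; apply: (idealB (prime_ideal (primeP i))).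
  have [n hn] : exists n, forall b, P i b -> ~ ideal_pow m n (x' - b).
    apply: contrapT => /forallNP h; apply: nPx'; apply: prime_closed => // n.
    have /existsNP[b /not_implyP[Pb /contrapT]] := h n.
    by exists b.
  exists (x', maxn n k.+1, i.+1); split=> //=; first by rewrite leq_max ltnSn orbT.
  move=> y yx Py; apply: (hn y Py); rewrite -opprB.
  apply: (idealN (ideal_pow_ideal _)); apply: ideal_pow_dec yx.
  exact: leq_maxl.
(* The ball around 0 of precision 1 is [m], which keeps the limit in [m]. *)
have [f [f0 fS]] := dependent_choice nextP (0, 1%N, 0%N).
pose x n := (f n).1.1; pose k n := (f n).1.2.
have f2 n : (f n).2 = n.
  by elim: n => [|n IH]; [rewrite f0|case: (fS n) => -> _ _ _; rewrite IH].
have kS n : (k n < k n.+1)%N by case: (fS n).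
have kn n : (n < k n)%N.
  by elim: n => [|n IH]; [rewrite /k f0|apply: leq_ltn_trans (kS n)].
have xS n : ideal_pow m (k n) (x n.+1 - x n) by case: (fS n).
have kmon n d : (k n <= k (n + d))%N.
  elim: d => [|d IH]; first by rewrite addn0.
  by rewrite addnS; apply: leq_trans IH (ltnW (kS _)).
have xD n d : ideal_pow m (k n) (x (n + d)%N - x n).
  elim: d => [|d IH].
    by rewrite addn0 subrr; apply: ideal0; apply: ideal_pow_ideal.
  rewrite addnS -(subrKA (x (n + d)%N)); apply: (idealD (ideal_pow_ideal _)) => //.
  exact: ideal_pow_dec (kmon n d) _ (xS _).
have [n|y yx] := compl x; first by apply: ideal_pow_dec (xS n); apply: ltnW.
(* Completeness bounds [y - x n] only modulo the n-th power; comparing with the later term of index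
   [n + k n] gives precision [k n]. *)
have yx' n : ideal_pow m (k n) (y - x n).
  rewrite -(subrKA (x (n + k n)%N)); apply: (idealD (ideal_pow_ideal _)) => //.
  by apply: ideal_pow_dec (yx _); apply: leq_addl.
exists y.
  have := yx' 0%N; rewrite /x /k f0 /= subr0; exact: ideal_pow1.
by move=> i; have [_ _ _] := fS i; rewrite f2; apply; apply: yx'.
Qed.

Lemma uncountable_prime_avoidance : ~ countable [set: {ideal_quot m}] ->
  exists2 x, M x & forall i, ~ P i x.
Proof.
move=> ncount; apply: contrapT => nx.
have cover x : M x -> exists i, P i x.
  move=> Mx; apply: contrapT => /forallNP h; apply: nx; by exists x.
have iM := ideal_of_idealr m.
have [k [v [Mv gen]]] := ideal_fg noethR iM.
(* A curve in [m] whose coefficients are the generators: its values at [k] distinct residues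
   determine the generators up to a Vandermonde determinant. *)
pose e (a : {ideal_quot m}) := \sum_j v j * repr a ^+ j.
have Me (a : {ideal_quot m}) : M (e a).
  by apply: (ideal_sum iM) => j; apply: (ideal_mulr iM).
have /choice[g gP] (a : {ideal_quot m}) : exists i, P i (e a) by apply: cover.
(* One prime contains [e a] for infinitely many residues [a], hence all the     *)
(* generators of [m], by a Vandermonde determinant.                            *)
have [i infi] : exists i, infinite_set (g @^-1` [set i]).
  apply: contrapT => /forallNP fin; apply: ncount.
  have -> : [set: {ideal_quot m}] = \bigcup_(i in setT) (g @^-1` [set i]).
    by apply/seteqP; split=> // a _; exists (g a).
  apply: bigcup_countable => // i _; apply: finite_set_countable.
  by have /contrapT := fin i.
have [B Bi kB] := infinite_set_fset k infi.
have uB : uniq (enum_fset B) by apply: fset_uniq.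
pose a (j : 'I_k) := nth 0 (enum_fset B) j.
have Pa j : P i (e (a j)).
  have aB : a j \in B by apply: mem_nth; apply: leq_trans kB.
  by have /= <- := Bi _ aB; apply: gP.
have pP := primeP i; have iP := prime_ideal pP.
have PM : P i `<=` M by apply: (proper_sub_max local_unit) => //; case: pP.
pose V := Vandermonde k (\row_j repr (a j)).
(* The determinant is a product of differences of representatives of distinct residues, none of
   which lies in [m]. *)
have nPdet : ~ P i (\det V).
  rewrite det_Vandermonde; apply: prime_prod => // i1 _.
  apply: prime_prod => // j1 lt_ij; rewrite !mxE => /PM Mij.
  have : repr (a j1) == repr (a i1) %[mod {ideal_quot m}].
    by rewrite -Quotient.idealrBE.
  rewrite !reprK nth_uniq ?(leq_trans _ kB) // => /eqP E.
  by rewrite E ltnn in lt_ij.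
apply: (MP (i := i)) => y /gen[c ->]; apply: (ideal_sum iP) => j.
apply: (ideal_mull iP); apply: contrapT => nPv.
apply: (primeM pP nPv nPdet).
have -> : v j * \det V = ((\row_j v j) *m V *m \adj V) 0 j.
  by rewrite -mulmxA mul_mx_adj mul_mx_scalar !mxE mulrC.
rewrite mxE; apply: (ideal_sum iP) => l; apply: (ideal_mulr iP).
rewrite mxE; have := Pa l; congr (P i _); apply: eq_bigr => l' _.
by rewrite !mxE.
Qed.

End Avoidance.
End LocalFacts.

(** * Stable annihilators and resolving subcategories *)

Section LinearMaps.
Variable R : comNzRingType.

Definition mklin (U V : lmodType R) (f : U -> V) (H : linear f) : {linear U -> V} :=
  HB.pack f (GRing.isLinear.Build R U V *:%R f H).

Section Kernel.
Variables (U V : lmodType R) (f : {linear U -> V}).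

Definition in_ker : {pred U} := fun x => f x == 0.

Lemma in_ker_submod : submod_closed in_ker.
Proof.
split; first by rewrite unfold_in linear0.
move=> a u v; rewrite !unfold_in => /eqP fu /eqP fv.
by rewrite linearP fu fv scaler0 addr0.
Qed.

HB.instance Definition _ := GRing.isSubmodClosed.Build R U in_ker in_ker_submod.

Record ker := Ker { kval : U; kvalP : kval \in in_ker }.
HB.instance Definition _ := [isSub for kval].
HB.instance Definition _ := [Choice of ker by <:].
HB.instance Definition _ := [SubChoice_isSubLmodule of ker by <:].

Lemma linear_kval : linear kval.
Proof. by move=> a u v; rewrite -[kval _]/(val _) linearP. Qed.
HB.instance Definition _ := GRing.isLinear.Build R ker U *:%R kval linear_kval.

Lemma kval_inj : injective kval.
Proof. exact: val_inj. Qed.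

Lemma mk_ker x : f x = 0 -> exists k : ker, kval k = x.
Proof.
move=> fx; have H : x \in in_ker by rewrite unfold_in fx.
by exists (Ker H).
Qed.

Lemma ker_eq0 (k : ker) : f (kval k) = 0.
Proof. by have := kvalP k; rewrite unfold_in => /eqP. Qed.

Lemma ker_lift (W : lmodType R) (g : {linear W -> U}) : (forall w, f (g w) = 0) ->
  exists h : {linear W -> ker}, forall w, kval (h w) = g w.
Proof.
move=> fg; have /choice[h hE] w : exists k : ker, kval k = g w by apply: mk_ker.
have lh : linear h by move=> a u v; apply: kval_inj; rewrite linearP /= !hE linearP.
by exists (mklin lh).
Qed.

End Kernel.

Lemma ker_exact (U V : lmodType R) (f : {linear U -> V}) :
  (forall y, exists x, f x = y) ->
  short_exact (@kval U V f : {linear _ -> _}) f.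
Proof.
move=> surj; split=> //; first exact: kval_inj.
move=> y; split=> [/mk_ker[k <-]|[k <-]]; first by exists k.
exact: ker_eq0.
Qed.

Lemma linear_descend (U V W : lmodType R) (f : {linear U -> V}) (g : {linear U -> W}) :
  (forall y, exists x, f x = y) -> (forall x, f x = 0 -> g x = 0) ->
  exists h : {linear V -> W}, forall x, h (f x) = g x.
Proof.
move=> /choice[s sE] fg; have gs x : g (s (f x)) = g x.
  apply/eqP; rewrite -subr_eq0 -linearB; apply/eqP/fg.
  by rewrite linearB sE subrr.
have lh : linear (g \o s).
  move=> a u v /=; rewrite -linearP; apply/eqP; rewrite -subr_eq0 -linearB.
  by apply/eqP/fg; rewrite linearB linearP !sE subrr.
by exists (mklin lh).
Qed.

Lemma linear_row n (V : lmodType R) (w : 'I_n -> V) :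
  linear (fun c : 'rV[R]_n => \sum_i c 0 i *: w i).
Proof.
move=> a u v; rewrite scaler_sumr -big_split; apply: eq_bigr => i _.
by rewrite !mxE scalerDl scalerA.
Qed.

Definition row_map n (V : lmodType R) (w : 'I_n -> V) := mklin (linear_row w).

Lemma row_map_surj n (V : lmodType R) (w : 'I_n -> V) :
  (forall x, exists c : 'I_n -> R, x = \sum_i c i *: w i) ->
  forall y, exists x, row_map w x = y.
Proof.
move=> gen y; have [c ->] := gen y; exists (\row_i c i).
by apply: eq_bigr => i _; rewrite mxE.
Qed.

Lemma row_mapE n (V : lmodType R) (g : {linear 'rV[R]_n -> V}) x :
  g x = \sum_i x 0 i *: g (delta_mx 0 i).
Proof.
by rewrite {1}(row_sum_delta x) linear_sum; apply: eq_bigr => i _; rewrite linearZ.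
Qed.

Lemma row_fg n : finitely_generated 'rV[R]_n.
Proof.
exists n, (delta_mx 0) => x; exists (x 0); exact: row_sum_delta.
Qed.

Lemma row_projective n : projective_module 'rV[R]_n.
Proof.
move=> M N g f surj; have /choice[w wE] i : exists y, g y = f (delta_mx 0 i) by [].
exists (row_map w) => x; rewrite [in RHS]row_mapE linear_sum.
by apply: eq_bigr => i _; rewrite linearZ /= wE.
Qed.

Lemma prod_projective (P Q : lmodType R) :
  projective_module P -> projective_module Q -> projective_module (P * Q)%type.
Proof.
move=> pP pQ M N g f surj.
have l1 : linear (fun y : P => f (y, 0)).
  by move=> a u v; rewrite -linearP; congr (f _); congr (_, _); rewrite /= scaler0 addr0.
have l2 : linear (fun y : Q => f (0, y)).
  by move=> a u v; rewrite -linearP; congr (f _); congr (_, _); rewrite /= scaler0 addr0.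
have [h1 h1E] := pP M N g (mklin l1) surj.
have [h2 h2E] := pQ M N g (mklin l2) surj.
have lh : linear (fun y : P * Q => h1 y.1 + h2 y.2).
  by move=> a u v; rewrite !linearP scalerDr addrACA.
exists (mklin lh) => -[y z] /=; rewrite linearD h1E h2E /= -linearD.
by congr (f _); congr (_, _); rewrite ?addr0 ?add0r.
Qed.

Lemma iso_sym (M N : lmodType R) : iso_module M N -> iso_module N M.
Proof.
move=> [f [g fK gK]]; have lg : linear g.
  by move=> a u v; apply: (can_inj fK); rewrite linearP !gK.
by exists (mklin lg); exists f.
Qed.

Lemma iso_swap (M N : lmodType R) : iso_module (M * N)%type (N * M)%type.
Proof.
have l : linear (fun y : M * N => (y.2, y.1)) by move=> a u v.
by exists (mklin l); exists (fun y => (y.2, y.1)) => -[].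
Qed.

(** Any matrix expressing [phi] on generators is killed by its characteristic polynomial, and
    therefore so is [phi]. *)
Lemma fg_Cayley_Hamilton (K : lmodType R) (phi : {linear K -> K}) :
  finitely_generated K -> exists n (a : 'I_n -> R),
    forall k, iter n phi k = \sum_i a i *: iter i phi k.
Proof.
move=> [[|n] [v gen]].
  exists 0%N, (fun=> 0) => k; have [c ->] := gen k.
  by rewrite !big_ord0.
have /choice[A AE] i : exists c : 'I_n.+1 -> R, phi (v i) = \sum_j c j *: v j by [].
pose B := \matrix_(i, j) A i j.
have iterv l i : iter l phi (v i) = \sum_j (B ^+ l) i j *: v j.
  elim: l i => [|l IH] i.
    rewrite (bigD1 i) //= expr0 mxE eqxx scale1r big1 ?addr0 // => j ji.
    by rewrite mxE eq_sym (negbTE ji) scale0r.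
  rewrite iterS IH linear_sum exprSr.
  under eq_bigr do rewrite linearZ /= AE scaler_sumr.
  rewrite exchange_big /=; apply: eq_bigr => j _.
  rewrite mxE scaler_suml; apply: eq_bigr => l' _.
  by rewrite scalerA mxE.
have iterl l (c : 'I_n.+1 -> R) (w : 'I_n.+1 -> K) :
    iter l phi (\sum_i c i *: w i) = \sum_i c i *: iter l phi (w i).
  elim: l => //= l ->; rewrite linear_sum; apply: eq_bigr => i _.
  by rewrite linearZ.
pose p := char_poly B.
have BE : B ^+ n.+1 = \sum_(i < n.+1) (- p`_i) *: B ^+ i.
  have := Cayley_Hamilton B; rewrite -/p /horner_mx /horner_morph.
  have sp : size p = n.+2 by rewrite size_char_poly.
  rewrite horner_poly sp big_ord_recr /=.
  have -> : p`_n.+1 = 1.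
    by have /monicP := char_poly_monic B; rewrite lead_coefE -/p sp.
  rewrite mul1r addrC => /eqP; rewrite addr_eq0 => /eqP ->.
  rewrite -sumrN; apply: eq_bigr => i _.
  by rewrite -mul_scalar_mx -mulNr; congr (_ * _); rewrite -rmorphN.
exists n.+1, (fun i => - p`_i) => k; have [c ->] := gen k.
rewrite iterl; under [RHS]eq_bigr do rewrite iterl scaler_sumr.
rewrite exchange_big; apply: eq_bigr => i _; rewrite iterv BE.
rewrite scaler_sumr; under [RHS]eq_bigr do rewrite iterv !scaler_sumr.
rewrite exchange_big /=; apply: eq_bigr => j _.
rewrite summxE scaler_suml scaler_sumr; apply: eq_bigr => l _.
by rewrite mxE !scalerA mulrCA mulrA.
Qed.

End LinearMaps.

Section StableAnnihilator.
Variable R : comNzRingType.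

(* The annihilator of the ring of endomorphisms of [M] modulo those factoring  *)
(* through a projective module; [V(stable_ann M)] is the nonfree locus of [M]. *)
Definition stable_ann (M : lmodType R) : set R :=
  [set s | exists (P : lmodType R) (f : {linear M -> P}) (g : {linear P -> M}),
     projective_module P /\ forall y, g (f y) = s *: y].

Lemma stable_ann_ideal M : ideal (stable_ann M).
Proof.
apply: idealP.
- exists 'rV[R]_0, (\0 : {linear M -> 'rV[R]_0}), (\0 : {linear 'rV[R]_0 -> M}).
  by split=> [|y]; [exact: row_projective|rewrite scale0r].
- move=> s t [P [f [g [pP E]]]] [P' [f' [g' [pP' E']]]].
  have lf : linear (fun y => (f y, f' y)).
    by move=> a u v; rewrite !linearP.
  have lg : linear (fun y : P * P' => g y.1 + g' y.2).
    by move=> a u v; rewrite !linearP scalerDr addrACA.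
  exists (P * P')%type, (mklin lf), (mklin lg); split; first exact: prod_projective.
  by move=> y /=; rewrite E E' scalerDl.
- move=> r s [P [f [g [pP E]]]].
  have lg : linear (fun y => r *: g y).
    by move=> a u v; rewrite linearP scalerDr !scalerA mulrC.
  exists P, f, (mklin lg); split=> // y /=.
  by rewrite E scalerA.
Qed.

(** The projective module of the definition may be exchanged for any given cover of [M]. *)
Lemma stable_ann_lift (M F : lmodType R) (pi : {linear F -> M}) s :
  (forall y, exists x, pi x = y) -> stable_ann M s ->
  exists u : {linear M -> F}, forall y, pi (u y) = s *: y.
Proof.
move=> surj [P [f [g [pP E]]]]; have [h hE] := pP F M pi g surj.
by exists (h \o f : {linear M -> F}) => y /=; rewrite hE E.
Qed.

Lemma stable_ann_retract (M N : lmodType R) (i : {linear M -> N}) (r : {linear N -> M}) :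
  cancel i r -> stable_ann N `<=` stable_ann M.
Proof.
move=> ir s [P [f [g [pP E]]]].
exists P, (f \o i : {linear M -> P}), (r \o g : {linear P -> M}); split=> // y /=.
by rewrite E linearZ /= ir.
Qed.

Lemma stable_ann_iso (M N : lmodType R) :
  iso_module M N -> stable_ann M = stable_ann N.
Proof.
have sub (A B : lmodType R) : iso_module A B -> stable_ann B `<=` stable_ann A.
  move=> [f [g fK gK]]; have lg : linear g.
    by move=> a u v; apply: (can_inj fK); rewrite linearP !gK.
  exact: (@stable_ann_retract A B f (mklin lg)).
by move=> MN; apply/seteqP; split; apply: sub => //; apply: iso_sym.
Qed.

Lemma stable_ann_prod (M N : lmodType R) :
  stable_ann (M * N)%type = stable_ann M `&` stable_ann N.
Proof.
have li : linear (fun y : M => (y, 0 : N)).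
  by move=> a u v; congr (_, _); rewrite /= scaler0 addr0.
have lj : linear (fun y : N => (0 : M, y)).
  by move=> a u v; congr (_, _); rewrite /= scaler0 addr0.
have lp : linear (fun y : M * N => y.1) by [].
have lq : linear (fun y : M * N => y.2) by [].
apply/seteqP; split=> s.
  move=> h; split.
    by move: h; apply: (@stable_ann_retract _ _ (mklin li) (mklin lp)).
  by move: h; apply: (@stable_ann_retract _ _ (mklin lj) (mklin lq)).
case=> -[P [f [g [pP E]]]] [P' [f' [g' [pP' E']]]].
have lf : linear (fun y : M * N => (f y.1, f' y.2)).
  by move=> a u v; rewrite !linearP.
have lg : linear (fun y : P * P' => (g y.1, g' y.2)).
  by move=> a u v; rewrite !linearP.
exists (P * P')%type, (mklin lf), (mklin lg); split; first exact: prod_projective.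
by move=> -[y z] /=; rewrite E E'.
Qed.

Section Pullback.
Variables (F M : lmodType R) (pi : {linear F -> M}) (x : R).
Hypothesis projF : projective_module F.
Hypothesis surj : forall y, exists f, pi f = y.

Lemma pullback_linear : linear (fun z : F * M => pi z.1 - x *: z.2).
Proof.
move=> a u v; rewrite linearP scalerDr !scalerA (mulrC x a) -scalerA.
by rewrite scalerBr opprD addrACA.
Qed.

Definition pullback_map := mklin pullback_linear.

(* The pullback of [pi] along multiplication by [x]: the middle term of the    *)
(* extension of [M] by [ker pi] whose class is [x] times that of [F].          *)
Local Notation N := (ker pullback_map).

Lemma pullbackP (n : N) : pi (kval n).1 = x *: (kval n).2.
Proof. by have := ker_eq0 n => /eqP; rewrite /= subr_eq0 => /eqP. Qed.

Lemma pullback_lift (W : lmodType R) (f : {linear W -> F}) (g : {linear W -> M}) :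
  (forall w, pi (f w) = x *: g w) ->
  exists h : {linear W -> N}, forall w, kval (h w) = (f w, g w).
Proof.
move=> fg; have l : linear (fun w => (f w, g w)) by move=> a u v; rewrite !linearP.
have [w|h hE] := @ker_lift _ _ _ pullback_map _ (mklin l); last by exists h.
by rewrite /= fg subrr.
Qed.

Lemma linear_pullback1 : linear (fun n : N => (kval n).1).
Proof. by move=> a u v; rewrite linearP. Qed.
Lemma linear_pullback2 : linear (fun n : N => (kval n).2).
Proof. by move=> a u v; rewrite linearP. Qed.

Lemma pullback_section : exists j : {linear F -> N},
  forall f, kval (j f) = (x *: f, pi f).
Proof.
have l : linear (fun f : F => x *: f).
  by move=> a u v; rewrite scalerDr !scalerA mulrC.
have [f|j jE] := @pullback_lift F (mklin l) pi; last by exists j.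
by rewrite linearZ.
Qed.

Lemma pullback_ker : exists i : {linear ker pi -> N},
  forall k, kval (i k) = (kval k, 0).
Proof.
have [k|j jE] := @pullback_lift _ (@kval R F M pi) \0; last by exists j.
by rewrite scaler0 ker_eq0.
Qed.

(** Multiplication by [x] on the pullback is the projection to [F] followed by
    [f |-> (x f, pi f)]. *)
Lemma pullback_mul : stable_ann N x.
Proof.
have [j jE] := pullback_section.
exists F, (mklin linear_pullback1), j; split=> // n; apply: kval_inj.
by rewrite jE pullbackP linearZ.
Qed.

(** With [u] lifting [s] to [F], the element [s (f, y)] is the sum of [(s f - u (pi f), 0)] and
    [(x u y, s y)], as [pi f = x y]; the two terms factor through one copy of [F] each. *)
Lemma pullback_stable_ann : stable_ann M `<=` stable_ann N.
Proof.
move=> s /(stable_ann_lift surj)[u uE].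
have [j jE] := pullback_section; have [i iE] := pullback_ker.
have lt : linear (fun f => s *: f - u (pi f)).
  move=> a f g; rewrite [pi _]linearP [u _]linearP scalerDr scalerBr !scalerA.
  by rewrite (mulrC s a) opprD addrACA.
have [f|t tE] := @ker_lift _ _ _ pi _ (mklin lt).
  by rewrite /= linearB linearZ /= uE subrr.
have la : linear (fun n : N => ((kval n).1, u (kval n).2)).
  by move=> a n n'; rewrite !linearP.
have lb : linear (fun z : F * F => i (t z.1) + j z.2).
  by move=> a z z'; rewrite !linearP scalerDr addrACA.
exists (F * F)%type, (mklin la), (mklin lb); split; first exact: prod_projective.
move=> n; apply: kval_inj; rewrite /= iE jE tE /= pullbackP uE.
case E : (kval n) (pullbackP n) => [f y] /= fy; congr (_, _); last by rewrite add0r.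
by rewrite linearZ /= subrK.
Qed.

(* If [s] kills [Ext^1 N (ker pi)], then [s - x phi] kills the class of [F] in  *)
(* [Ext^1 M (ker pi)] for some endomorphism [phi] of [ker pi]; hence so does    *)
(* [s^l - x^l phi^l] for all [l], and [phi] is integral over [R]. A map kills   *)
(* that class when it extends to [F] along the inclusion of [ker pi].           *)
Lemma pullback_stable_ann_sub s : finitely_generated (ker pi) -> stable_ann N s ->
  exists n b, stable_ann M (s ^+ n + x * b).
Proof.
move=> fgK [P [al [be [pP E]]]].
have [j jE] := pullback_section; have [i iE] := pullback_ker.
pose q := mklin linear_pullback2.
have [ga gaE] := pP F M pi (q \o be : {linear P -> M}) surj.
pose w n := ga (al n).
have wE n : pi (w n) = s *: (kval n).2.
  by rewrite /w gaE /= E linearZ.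
have lw : linear w by move=> a u v; rewrite /w !linearP.
(* [w] lifts to [F] the map [s] times the projection to [M], so it sends the copy of [ker pi] in the
   pullback into [ker pi]. *)
have [k|phi phiE] := @ker_lift _ _ _ pi _ (mklin lw \o i : {linear ker pi -> F}).
  by rewrite /= wE iE scaler0.
have lh : linear (fun f => s *: f - w (j f)).
  move=> a f g; rewrite [j _]linearP lw scalerDr scalerBr !scalerA.
  by rewrite (mulrC s a) opprD addrACA.
have [f|h hE] := @ker_lift _ _ _ pi _ (mklin lh).
  by rewrite /= linearB linearZ /= wE jE subrr.
have ji (k : ker pi) : j (kval k) = x *: i k.
  apply: kval_inj; rewrite jE linearZ /= iE ker_eq0.
  by congr (_, _); rewrite /= scaler0.
have hk (k : ker pi) : h (kval k) = s *: k - x *: phi k.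
  apply: kval_inj; rewrite hE /= ji phiE /= /w.
  by rewrite [al _]linearZ [ga _]linearZ.
have /choice[H HE] l : exists H : {linear F -> ker pi}, forall k : ker pi,
    H (kval k) = s ^+ l *: k - x ^+ l *: iter l phi k.
  elim: l => [|l [H HE]].
    by exists \0 => k; rewrite /= !expr0 !scale1r subrr.
  (* On [ker pi] this is [x phi (s^l - x^l phi^l) + s^l (s - x phi)], which telescopes. *)
  have lH : linear (fun f => x *: phi (H f) + s ^+ l *: h f).
    move=> a f g; rewrite [H _]linearP [phi _]linearP [h _]linearP !scalerDr.
    by rewrite !scalerA (mulrC x a) (mulrC _ a) addrACA.
  exists (mklin lH) => k; rewrite /= HE hk [phi _]linearB.
    rewrite [phi (_ *: k)]linearZ [phi (_ *: iter _ _ _)]linearZ /=.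
    rewrite !scalerBr !scalerA.
  by rewrite -!exprS -exprSr (mulrC x) addrC addrA subrK.
have [n [a aE]] := fg_Cayley_Hamilton phi fgK.
(* The monic equation of [phi], homogenized and evaluated at [s] and [x]. Combining the [H l] with
   the same coefficients cancels all powers of [phi], so [H n - S] extends multiplication by [d]
   from [ker pi] to [F]. *)
pose d := s ^+ n - \sum_(l < n) a l * x ^+ (n - l) * s ^+ l.
have lS : linear (fun f => \sum_(l < n) (a l * x ^+ (n - l)) *: H l f).
  move=> c f g; rewrite scaler_sumr -big_split; apply: eq_bigr => l _.
  by rewrite [H l _]linearP scalerDr !scalerA mulrC.
pose S := mklin lS.
have ld : linear (fun f => d *: f - kval (H n f - S f)).
  move=> c f g; rewrite [H n _]linearP [S _]linearP.
  have -> : c *: H n f + H n g - (c *: S f + S g)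
          = c *: (H n f - S f) + (H n g - S g).
    by rewrite scalerBr opprD addrACA.
  rewrite [kval _]linearP scalerDr scalerBr !scalerA (mulrC d).
  by rewrite opprD addrACA.
(* The difference of [d] and this extension vanishes on [ker pi], so it descends to a lift [u] of
   [d] from [M] to [F]. *)
have [f f0|u uE] := @linear_descend _ _ _ _ pi (mklin ld) surj.
  have [k <-] := mk_ker f0.
  suff HS : H n (kval k) - S (kval k) = d *: k.
    rewrite -[LHS]/(d *: kval k - kval (H n (kval k) - S (kval k))) HS.
    by rewrite [kval (_ *: _)]linearZ subrr.
  rewrite HE /S /=.
  under eq_bigr do rewrite HE scalerBr !scalerA -[_ * x ^+ _ * x ^+ _]mulrA -exprD.
  rewrite sumrB aE scaler_sumr.
  have -> : \sum_(l < n) (a l * x ^+ (n - l + l)) *: iter l phi k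
     = \sum_(l < n) x ^+ n *: (a l *: iter l phi k).
    by apply: eq_bigr => l _; rewrite subnK ?(ltnW (ltn_ord l)) // scalerA mulrC.
  by rewrite opprB addrA subrK -scaler_suml -scalerBl.
exists n, (- \sum_(l < n) a l * x ^+ (n - l).-1 * s ^+ l).
have -> : s ^+ n + x * - (\sum_(l < n) a l * x ^+ (n - l).-1 * s ^+ l) = d.
  rewrite mulrN mulr_sumr; congr (_ - _); apply: eq_bigr => l _.
  have -> : x ^+ (n - l) = x * x ^+ (n - l).-1.
    by rewrite -exprS prednK // subn_gt0.
  by ring.
exists F, u, pi; split=> // y; have [f <-] := surj y.
rewrite uE -[mklin ld f]/(d *: f - kval (H n f - S f)).
by rewrite [pi _]linearB ker_eq0 subr0 linearZ.
Qed.

End Pullback.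

Section Resolving.
Variable X : lmodType R -> Prop.
Hypothesis resX : resolving X.

(** The last clause expresses, prime by prime, that [stable_ann N] lies in the radical of
    [stable_ann M + (x)]. *)
Lemma resolving_pullback M x : X M -> exists N, [/\ X N, stable_ann N x,
  stable_ann M `<=` stable_ann N &
  forall P, prime_set P -> P x -> stable_ann M `<=` P -> stable_ann N `<=` P].
Proof.
move=> XM; have [n [v gen]] := subcategory_fg (resolving_subcategory resX) XM.
pose F := 'rV[R]_n; pose pi := row_map v.
have surj := row_map_surj gen.
have pF : projective_module F by exact: row_projective.
have XF : X F by apply: resolving_projective pF => //; apply: row_fg.
have XK : X (ker pi) by apply: resolving_kernel (ker_exact surj) XF XM.
have [i iE] := pullback_ker pi x.
exists (ker (pullback_map pi x)); split.
- apply: (@resolving_extension _ _ resX _ _ _ i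
    (mklin (@linear_pullback2 _ _ pi x))) => //.
  split.
  + move=> k k' /(congr1 (@kval _ _ _ _)); rewrite !iE => -[]; exact: kval_inj.
  + move=> y; have [f fE] := surj (x *: y).
    have [|k kE] := @mk_ker _ _ _ (pullback_map pi x) (f, y).
      by rewrite -[LHS]/(pi f - x *: y) fE subrr.
    by exists k; rewrite /= kE.
  + move=> k; split=> [k0|[k' <-]]; last by rewrite /= iE.
    have [|k' k'E] := @mk_ker _ _ _ pi (kval k).1.
      by rewrite pullbackP [(kval k).2]k0 scaler0.
    exists k'; apply: kval_inj; rewrite iE k'E [RHS]surjective_pairing.
    by congr (_, _); rewrite -[LHS]k0.
- exact: pullback_mul.
- exact: pullback_stable_ann.
move=> P pP Px MP s /(pullback_stable_ann_sub pF surj)[|l [b /MP h]].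
  exact: (subcategory_fg (resolving_subcategory resX) XK).
apply: (primeX pP (n := l)); rewrite -(addrK (x * b) (s ^+ l)).
apply: (idealB (prime_ideal pP)) => //; exact: (ideal_mulr (prime_ideal pP)).
Qed.

Lemma resolving_prime_stable_ann M P : noetherian R -> X M -> prime_set P ->
  stable_ann M `<=` P -> exists2 N, X N & stable_ann N = P.
Proof.
move=> noethR XM pP MP; have iP := prime_ideal pP.
have [k [v [Pv gen]]] := ideal_fg noethR iP.
have /(_ [seq v i | i <- enum 'I_k])[|N [XN NP vN]] : forall s : seq R,
    (forall x, x \in s -> P x) -> exists N,
    [/\ X N, stable_ann N `<=` P & forall x, x \in s -> stable_ann N x].
  elim=> [_|x s IH xsP]; first by exists M.
  have [y ys|N [XN NP sN]] := IH; first by apply: xsP; rewrite inE ys orbT.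
  have Px : P x by apply: xsP; rewrite inE eqxx.
  have [N' [XN' xN' NN' h]] := resolving_pullback x XN.
  exists N'; split=> //; first exact: h.
  by move=> y; rewrite inE => /orP[/eqP ->|/sN /NN'].
  by move=> _ /mapP[i _ ->].
exists N => //; apply/seteqP; split=> // y /gen[c ->].
apply: (ideal_sum (stable_ann_ideal _)) => i.
by apply/(ideal_mull (stable_ann_ideal _))/vN/map_f; rewrite mem_enum.
Qed.

Variable m : set R.
Hypothesis pm : prime_set m.
Hypothesis unit_m : forall x, ~ m x -> exists y, y * x = 1.

Definition generated_by n (M : lmodType R) :=
  exists v : 'I_n -> M, forall x, exists c : 'I_n -> R, x = \sum_i c i *: v i.

Lemma generated_by_iso n M N : iso_module M N -> generated_by n M -> generated_by n N.
Proof.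
move=> [f [g fK gK]] [v gen]; exists (f \o v) => y.
have [c E] := gen (g y); exists c; rewrite -(gK y) E linear_sum.
by apply: eq_bigr => i _; rewrite linearZ.
Qed.

(** Makes the number of generators decrease in the splitting of [resolving_indecomposable]. *)
Lemma generated_by_summand n (M N : lmodType R) :
  generated_by n (M * N)%type -> ~ zero_module N ->
  exists2 k, (k < n)%N & generated_by k M.
Proof.
move=> [v gen] nN.
have sum2 (c : 'I_n -> R) : \sum_i c i *: v i =
    (\sum_i c i *: (v i).1, \sum_i c i *: (v i).2).
  by rewrite [LHS]surjective_pairing (big_morph fst (fun _ _ => erefl) erefl)
      (big_morph snd (fun _ _ => erefl) erefl).
(* Writing [(0, (v i).2)] in terms of the generators, some coefficient is a    *)
(* unit by Nakayama's lemma; the corresponding generator is superfluous.       *)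
have /choice[c cE] i : exists c : 'I_n -> R,
    0 = \sum_j c j *: (v j).1 /\ (v i).2 = \sum_j c j *: (v j).2.
  by have [c] := gen (0, (v i).2); rewrite sum2 => -[]; exists c.
have [[i [j nmc]]|allm] := pselect (exists i j, ~ m (c i j)); last first.
  case: nN => y.
  have [|||i|s ns sv] := @prime_nakayama R m N [set 0] n (fun i => (v i).2)
    (fun=> 1) c pm.
  - by split=> [|u u' /= -> ->|r u /= ->] //; rewrite ?addr0 ?scaler0.
  - by case: pm.
  - by move=> i j; apply: contrapT => h; apply: allm; exists i, j.
  - by rewrite scale1r /= -(cE i).2 subrr.
  have [t ts] := unit_m ns.
  have [d] := gen (0, y); rewrite sum2 => -[_ ->]; apply: big1 => i _.
  by rewrite -[(v i).2]scale1r -ts -scalerA [s *: _]sv !scaler0.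
have [t tc] := unit_m nmc.
case: n v gen sum2 c cE i j nmc tc => [|n] v gen sum2 c cE i j nmc tc.
  by have := ltn_ord j; rewrite ltn0.
exists n => //; exists (fun l => (v (lift j l)).1) => y.
have [d] := gen (y, 0); rewrite sum2 => -[-> _].
exists (fun l => d (lift j l) - d j * t * c i (lift j l)).
have vj : (v j).1 = - \sum_l (t * c i (lift j l)) *: (v (lift j l)).1.
  have := (cE i).1; rewrite (bigD1_ord j) //= => /esym/eqP; rewrite addr_eq0.
  move=> /eqP /(congr1 ( *:%R t)); rewrite scalerA tc scale1r => ->.
  rewrite scalerN scaler_sumr; congr (- _); apply: eq_bigr => l _.
  by rewrite scalerA.
rewrite (bigD1_ord j) //= vj scalerN scaler_sumr addrC.
rewrite -sumrB; apply: eq_bigr => l _.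
by rewrite scalerBl scalerA mulrA.
Qed.

(** Splitting [N] writes the prime [P] as an intersection of two stable annihilators, one of which
    must be [P]; recursion on that summand ends because it needs fewer generators. *)
Lemma resolving_indecomposable P N : prime_set P -> X N -> stable_ann N = P ->
  exists L, [/\ X L, indecomposable L & stable_ann L = P].
Proof.
move=> pP XN; have [n fgN] := subcategory_fg (resolving_subcategory resX) XN.
have {fgN} : generated_by n N by [].
elim/ltn_ind: n N XN => n IH N XN gN NP.
have nzN : ~ zero_module N.
  move=> N0; case: pP => _ + _; apply; rewrite -NP.
  exists 'rV[R]_0, \0, \0; split; first exact: row_projective.
  by move=> y; rewrite scale1r (N0 y).
have [indN|nind] := pselect (indecomposable N); first by exists N.
have [A [B [isoN nA nB]]] : exists A B : lmodType R,
    [/\ iso_module N (A * B)%type, ~ zero_module A & ~ zero_module B].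
  apply: contrapT => h; apply: nind; split=> // A B isoN.
  have [|nA] := pselect (zero_module A); [by left|right].
  by apply: contrapT => nB; apply: h; exists A, B.
have XAB : X (A * B)%type.
  exact: (subcategory_iso (resolving_subcategory resX) isoN XN).
have XBA : X (B * A)%type.
  exact: (subcategory_iso (resolving_subcategory resX) (iso_swap A B) XAB).
have gAB := generated_by_iso isoN gN.
have gBA := generated_by_iso (iso_swap A B) gAB.
have [k kn gA] := generated_by_summand gAB nB.
have [l ln gB] := generated_by_summand gBA nA.
have ABP : stable_ann A `&` stable_ann B = P.
  by rewrite -stable_ann_prod -NP (stable_ann_iso isoN).
have [AP|nAP] := pselect (stable_ann A `<=` P).
  apply: (IH k kn A) => //; first exact: resolving_summand XAB.
  by apply/seteqP; split=> //; rewrite -ABP; apply: subIsetl.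
apply: (IH l ln B) => //; first exact: resolving_summand XBA.
apply/seteqP; split; last by rewrite -ABP; apply: subIsetr.
move: nAP => /existsNP[a /not_implyP[Aa nPa]] b Bb.
have : P (a * b).
  rewrite -ABP; split; first exact: (ideal_mulr (stable_ann_ideal _)).
  exact: (ideal_mull (stable_ann_ideal _)).
by case: pP => _ _ h /h[].
Qed.

End Resolving.
End StableAnnihilator.

(** * Freeness of localizations *)

(** [free_module] sums over vectors, not indices; the family is injective because its independence
    separates [v i] from [v j]. *)
Lemma free_module_of_basis (A : comNzRingType) (M : lmodType A) n (v : 'I_n -> M) :
  (forall x, exists c : 'I_n -> A, x = \sum_i c i *: v i) ->
  (forall c : 'I_n -> A, \sum_i c i *: v i = 0 -> forall i, c i = 0) ->
  free_module M.
Proof.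
move=> gen ind.
have injv : injective v.
  move=> i j vij; apply: contrapT => /eqP nij.
  have := ind (fun l => (l == i)%:R - (l == j)%:R).
  have -> : \sum_l ((l == i)%:R - (l == j)%:R) *: v l = 0.
    under eq_bigr do rewrite scalerBl.
    rewrite sumrB (bigD1 i) //= (bigD1 j (P := xpredT)) //= !eqxx !scale1r vij.
    rewrite !big1 ?subrr // => l /negbTE ->; exact: scale0r.
  move=> /(_ erefl i)/eqP; rewrite eqxx (negbTE nij) subr0; exact/negP/oner_neq0.
exists (range v); split.
  move=> x; have [c ->] := gen x.
  exists [seq v i | i <- enum 'I_n], (fun b => \sum_(i | v i == b) c i); split.
    by move=> _ /mapP[i _ ->]; exists i.
  rewrite big_map big_enum; apply: eq_bigr => i _; congr (_ *: _).
  by rewrite (big_pred1 i) // => j; rewrite (inj_eq injv).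
move=> s c us sB s0 b bs.
have [i _ vi] := sB b bs.
have := ind (fun i => if v i \in s then c (v i) else 0).
rewrite (_ : \sum_i _ = \sum_(b <- s) c b *: b) => [/(_ s0 i)|].
  by rewrite vi bs.
rewrite [LHS](bigID (fun i => v i \in s)) /= [X in _ + X]big1 ?addr0; last first.
  by move=> l /negbTE ->; exact: scale0r.
under eq_bigr => l -> do [].
rewrite -(big_map v (fun b => b \in s) (fun b => c b *: b)).
rewrite -big_filter; apply: perm_big; apply: uniq_perm => //.
  by rewrite filter_uniq // map_inj_uniq // index_enum_uniq.
move=> y; rewrite mem_filter andb_idr // => /sB[l _ <-].
by apply: map_f; rewrite mem_index_enum.
Qed.

Section LocallyFree.
Variables (R : comNzRingType) (p : spec R) (M : lmodType R).
Hypothesis fgM : finitely_generated M.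

Let P : set R := [set x | x \in (p : prime_idealr R)].

Lemma spec_prime_set : prime_set P.
Proof.
split; first exact: (ideal_of_idealr (p : prime_idealr R)).
  by rewrite /P /= idealr1.
by move=> a b; rewrite /P /= prime_idealrM => /orP.
Qed.

Let pP := spec_prime_set.

(** Inverting [s] turns [v] and [f] into a dual basis; with the denominator cleared, everything
    stays over [R]. *)
Definition local_dual_basis n : Prop :=
  exists s (v : 'I_n -> M) (f : 'I_n -> {linear M -> R^o}),
    ~ P s /\ forall y, s *: y = \sum_i f i y *: v i.

Lemma dual_basis_of_stable_ann s : ~ P s -> stable_ann M s ->
  exists n, local_dual_basis n.
Proof.
move=> nPs sM; have [n [v gen]] := fgM.
have [u uE] := stable_ann_lift (row_map_surj gen) sM.
have lf i : linear (fun y => u y 0 i : R^o).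
  by move=> a y z; rewrite linearP !mxE.
by exists n, s, v, (fun i => mklin (lf i)); split=> // y; rewrite -uE.
Qed.

(** Scale the expansion by [c i] and use the relation to replace [c i *: v i] by the other
    vectors. *)
Lemma dual_basis_shrink n s (v : 'I_n -> M) (f : 'I_n -> {linear M -> R^o}) c i :
  ~ P s -> (forall y, s *: y = \sum_i f i y *: v i) ->
  \sum_i c i *: v i = 0 -> ~ P (c i) ->
  exists2 k, (k < n)%N & local_dual_basis k.
Proof.
case: n v f c i => [|n] v f c i nPs fE cv nPc; first by have := ltn_ord i; rewrite ltn0.
exists n => //.
have lg j : linear (fun y => c i * f (lift i j) y - c (lift i j) * f i y : R^o).
  move=> a y z; rewrite !linearP /=.
  by rewrite /GRing.scale /=; ring.
exists (c i * s), (fun j => v (lift i j)), (fun j => mklin (lg j)); split.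
  exact: primeM.
move=> y /=; under eq_bigr do rewrite scalerBl -!scalerA.
rewrite sumrB -scaler_sumr.
under [X in _ = _ - X]eq_bigr do rewrite scalerA mulrC -scalerA.
rewrite -scaler_sumr -scalerA fE (bigD1_ord i) //= scalerDr addrC; congr (_ + _).
move: cv; rewrite (bigD1_ord i) //= => /eqP; rewrite addrC addr_eq0 => /eqP ->.
by rewrite scalerN opprK !scalerA mulrC.
Qed.

(** At minimal length every relation has its coefficients in [P]. The expansions of the [v j] are
    relations, so the matrix [s - (f j (v i))] has entries in [P]; applying each [f j] to a relation
    [c] shows that [s c] is this matrix times [c], and Nakayama kills [c] locally. *)
Lemma minimal_dual_basis s : ~ P s -> stable_ann M s ->
  exists n s (v : 'I_n -> M) (f : 'I_n -> {linear M -> R^o}),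
  [/\ ~ P s, forall y, s *: y = \sum_i f i y *: v i &
    forall c, \sum_i c i *: v i = 0 -> exists2 t, ~ P t & forall i, t * c i = 0].
Proof.
move=> nPs sM; have exn : exists n, `[< local_dual_basis n >].
  by have [n ?] := dual_basis_of_stable_ann nPs sM; exists n; apply/asboolP.
case: (ex_minnP exn) => n /asboolP[{nPs sM}s [v [f [nPs fE]]]] minn.
exists n, s, v, f; split=> // c cv.
have rel (d : 'I_n -> R) i : \sum_i d i *: v i = 0 -> P (d i).
  move=> dv; apply: contrapT => nPd.
  have [k kn /asboolP/minn] := dual_basis_shrink nPs fE dv nPd.
  by rewrite leqNgt kn.
have i0 : submod ([set 0] : set R^o).
  by split=> [|u u' /= -> ->|r u /= ->] //; rewrite ?addr0 ?scaler0.
have sumdelta (V : lmodType R) (w : 'I_n -> V) j :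
    \sum_i (s * (i == j)%:R) *: w i = s *: w j.
  rewrite (bigD1 j) //= eqxx mulr1 big1 ?addr0 // => i /negbTE ->.
  by rewrite mulr0 scale0r.
have [//|i j|j|t nPt tc] := @prime_nakayama R P R^o [set 0] n c (fun=> s)
  (fun j i => s * (i == j)%:R - f j (v i)) pP i0.
- apply: (rel (fun i' => s * (j == i')%:R - f i' (v j))).
  under eq_bigr do rewrite scalerBl eq_sym.
  by rewrite sumrB sumdelta -fE subrr.
- rewrite /=; under eq_bigr do rewrite scalerBl.
  rewrite sumrB sumdelta opprB addrC subrK.
  have := congr1 (f j) cv; rewrite linear0 linear_sum => fcv.
  rewrite -[RHS]fcv; apply: eq_bigr => i _; rewrite linearZ.
  exact: mulrC.
by exists t.
Qed.

Lemma lfrac_sum n (y : 'I_n -> M) (d : denom p) :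
  \sum_i lfrac (y i) d = lfrac (\sum_i y i) d.
Proof.
elim/big_ind2: _ => // [|x x' z z' -> ->].
  by apply/lfracP; exists (denom1 p); rewrite !scaler0.
rewrite lfracD; apply/lfracP; exists (denom1 p) => /=.
by rewrite !mul1r -scalerDr scalerA.
Qed.

Lemma common_denominator n (c : 'I_n -> locring p) :
  exists (a : 'I_n -> R) (d : denom p), forall i, c i = lfrac (a i : R^o) d.
Proof.
have /choice[as_ asE] i : exists q : R * denom p, c i = lfrac (q.1 : R^o) q.2.
  by elim/lring_ind: (c i) => a s; exists (a, s).
pose e (i : 'I_n) := \prod_(j < n | j != i) dval (as_ j).2.
have nPd : \prod_(j < n) dval (as_ j).2 \notin (p : prime_idealr R).
  apply/negP; apply: (@prime_prod _ P) => // j _; apply/negP/dvalP.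
exists (fun i => (as_ i).1 * e i), (Denom nPd) => i.
rewrite asE; apply/lringP; exists (denom1 p) => /=.
by rewrite (bigD1 i) //= -/(e i); ring.
Qed.

Lemma locally_free s : ~ P s -> stable_ann M s ->
  free_module (localize p M : lmodType (locring p)).
Proof.
move=> nPs sM; have [n [{nPs sM}s [v [f [nPs fE ind]]]]] := minimal_dual_basis nPs sM.
have sP : s \notin (p : prime_idealr R) by apply/negP.
apply: (@free_module_of_basis _ _ n (fun i => lfrac (v i) (denom1 p))).
  elim/lfrac_ind=> y t.
  exists (fun i => lfrac (f i y : R^o) (denomM (Denom sP) t)).
  under eq_bigr do rewrite [_ *: _]lscaleE.
  rewrite lfrac_sum -fE; apply/lfracP; exists (denom1 p) => /=.
  by rewrite scalerA; congr (_ *: _); ring.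
move=> c cv i; have [a [d aE]] := common_denominator c.
have : \sum_i lfrac (a i *: v i) (denomM d (denom1 p)) = 0 :> localize p M.
  rewrite -[RHS]cv; apply: eq_bigr => l _.
  by rewrite aE [RHS]lscaleE.
rewrite lfrac_sum => /lfracP[u]; rewrite scaler0 /= mulr1.
rewrite scaler_sumr; under eq_bigr do rewrite scalerA.
move=> /ind[t nPt /(_ i) ta].
have tP : t \notin (p : prime_idealr R) by apply/negP.
rewrite aE; apply/lringP; exists (denomM (Denom tP) u).
by rewrite /= mulr0 -[RHS]ta; ring.
Qed.

End LocallyFree.

(** * The dimension of the nonfree locus *)

Lemma prime_preimage (R S : comNzRingType) (f : {rmorphism R -> S}) (Q : set S) :
  prime_set Q -> prime_set (f @^-1` Q).
Proof.
move=> [iQ nQ1 QM]; split; last 2 first.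
- by rewrite /= rmorph1.
- by move=> a b; rewrite /= rmorphM; apply: QM.
apply: idealP => /=.
- by rewrite rmorph0; apply: ideal0.
- by move=> a b; rewrite rmorphD; apply: idealD.
- by move=> r a; rewrite rmorphM; apply: ideal_mull.
Qed.

Lemma prime_is_stable_ann (R : comNzRingType) (m : idealr R) (X : lmodType R -> Prop)
    (E : nat -> lmodType R) (M : lmodType R) (Q : set R) :
  noetherian R -> local_with m -> resolving X ->
  (forall M, X M -> indecomposable M -> exists n, iso_module M (E n)) ->
  X M -> prime_set Q -> stable_ann M `<=` Q -> exists n, stable_ann (E n) = Q.
Proof.
move=> noethR locR resX EX XM pQ MQ.
have [N XN NQ] := resolving_prime_stable_ann resX noethR XM pQ MQ.
have [L [XL indL LQ]] := resolving_indecomposable resX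
  (local_prime noethR locR) (local_unit noethR locR) pQ XN NQ.
have [n isoL] := EX L XL indL.
by exists n; rewrite -(stable_ann_iso isoL).
Qed.

Theorem theoremB (R : comNzRingType) (m : idealr R) (X : lmodType R -> Prop) :
  noetherian R ->
  local_with m ->
  complete_at m \/ ~ countable [set: {ideal_quot m}]%classic ->
  resolving X ->
  countably_many_indecomposables X ->
  (dim_locus (nonfree_locus_of X) <= 1)%E.
Proof.
move=> noethR locR compl resX [E EX].
apply/(dim_locus_le _ 1) => p [M XM nfree] n q chain.
rewrite leqNgt; apply/negP => n_gt1.
have pm := local_prime noethR locR; have um := local_unit noethR locR.
set m' : set R := [set x | x \in m] in pm um.
(* The chain of primes of R/p is pulled back to [R]. *)
pose Q i : set R := [set r | \pi_{ideal_quot p} r \in (q i : prime_idealr _)].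
have pQ i : prime_set (Q i).
  exact: (prime_preimage (\pi_{ideal_quot p} : {rmorphism R -> {ideal_quot p}})
    (spec_prime_set (q i))).
have Qm i : Q i `<=` m'.
  by apply: (proper_sub_max um); case: (pQ i).
have Qsub i : (i < n)%N -> Q i `<=` Q i.+1.
  by move=> /chain[h _] r; apply: h.
have Qstrict i : (i < n)%N -> ~ Q i.+1 `<=` Q i.
  move=> /chain[_ [y yq nyq]] h; move: nyq; rewrite -(reprK y).
  by apply/negP/negPn/h; rewrite /Q /= reprK.
have MQ0 : stable_ann M `<=` Q 0%N.
  move=> s sM; suff sp : s \in (p : prime_idealr R).
    rewrite /Q /= (_ : \pi s = 0) ?idealr0 //.
    by apply/eqP; rewrite -(rmorph0 \pi_{ideal_quot p}) -Quotient.idealrBE subr0.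
  apply: contrapT => nsp; apply: nfree.
  exact: (locally_free (subcategory_fg (resolving_subcategory resX) XM) nsp sM).
have isE Q' : prime_set Q' -> Q 0%N `<=` Q' -> exists k, stable_ann (E k) = Q'.
  move=> pQ' QQ'; apply: (prime_is_stable_ann noethR locR resX EX XM pQ').
  exact: subset_trans QQ'.
pose good k := prime_set (stable_ann (E k)) /\ ~ m' `<=` stable_ann (E k).
(* The default [Q 0] is itself a prime not containing [m'], so that avoidance applies to the whole
   sequence. *)
pose P k := if `[< good k >] then stable_ann (E k) else Q 0%N.
have pP k : prime_set (P k) by rewrite /P; case: asboolP => [[]|].
have mP k : ~ m' `<=` P k.
  rewrite /P; case: asboolP => [[] //|_] h; apply: (Qstrict 0%N); first by lia.
  exact: subset_trans (Qm 1%N) h.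
have [x mx nPx] : exists2 x, m' x & forall k, ~ P k x.
  case: compl => [cm|nc]; first exact: complete_prime_avoidance.
  exact: uncountable_prime_avoidance.
have xm Q' : prime_set Q' -> Q 0%N `<=` Q' -> Q' x -> m' `<=` Q'.
  move=> pQ' QQ' Q'x; apply: contrapT => nm; have [k Ek] := isE Q' pQ' QQ'.
  apply: (nPx k); rewrite /P; case: asboolP => [_|[]]; first by rewrite Ek.
  by rewrite /good Ek.
have n_gt0 : (0 < n)%N by lia.
(* Either outcome collapses a step of the chain: [Q 1] inside [Q 0], or [Q 2] inside [m'] and hence
   inside [Q 1]. *)
have [] := height_le1 noethR pm um (pQ 0%N) (pQ 1%N) (Qsub _ n_gt0) mx xm.
  exact: Qstrict.
by move=> mQ1; apply: (Qstrict 1%N) => //; apply: subset_trans mQ1.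
Qed.
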